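(* For each $n$, let $p=p(n)$ and $\rho=\rho(n)\in\mathbb{R}^p$, and let $\sigma>0$ be a fixed constant. Observe $x_1,\dots,x_n\in\mathbb{R}^p$ from the single component model $$x_i = v_i\rho+\sigma z_i,\qquad i=1,\dots,n,$$ where $v_1,\dots,v_n$ are i.i.d. $N(0,1)$, $z_1,\dots,z_n$ are i.i.d. $N_p(0,I_p)$, and all the $v_i$ and $z_i$ are mutually independent. Assume $\lim_{n\to\infty} p(n)/n=c\in[0,\infty)$ and $\lim_{n\to\infty}\|\rho(n)\|=\varrho>0$. Let $S=n^{-1}\sum_{i=1}^n x_ix_i^T$ and let $\hat\rho$ be a unit eigenvector of $S$ associated with its largest eigenvalue. Define $$\zeta(\tau;c)=\frac{4\sqrt c}{\tau}\Bigl(1+\frac{2+\sqrt c}{\tau}\Bigr).$$ Then, provided $\zeta(\varrho/\sigma;c)\le 1$, with probability one $$\limsup_{n\to\infty}\ \sin\angle(\hat\rho,\rho)\le \zeta(\varrho/\sigma;c).$$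
   Context: For nonzero $\xi,\eta\in\mathbb{R}^p$, the angle is $\angle(\xi,\eta)=\cos^{-1}\bigl(|\xi^T\eta|/(\|\xi\|_2\|\eta\|_2)\bigr)\in[0,\pi/2]$; in particular it does not depend on the signs of $\xi,\eta$, and $\sin\angle(\hat\rho,\rho)=\sqrt{1-(\rho^T\hat\rho)^2/\|\rho\|^2}$ for unit $\hat\rho$. All quantities $p,\rho$ may depend on $n$; $\sigma$ does not. *)

(* Defs.v *)
From HB Require Import structures.
From mathcomp Require Import all_boot all_order all_algebra.
From mathcomp Require Import all_classical all_reals all_analysis.
Set Implicit Arguments. Unset Strict Implicit. Unset Printing Implicit Defensive.
Import Order.TTheory GRing.Theory Num.Theory.
Local Open Scope classical_set_scope.
Local Open Scope ring_scope.

Section defs.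
Context {R : realType}.

Definition dotv (p : nat) (a b : 'cV[R]_p) : R := (a^T *m b) 0 0.
Definition vnorm (p : nat) (a : 'cV[R]_p) : R := Num.sqrt (dotv a a).

(* angle between nonzero vectors, in [0, pi/2] *)
Definition vangle (p : nat) (a b : 'cV[R]_p) : R :=
  acos (`|dotv a b| / (vnorm a * vnorm b)).

Definition top_unit_eigvec (p : nat) (A : 'M[R]_p) (u : 'cV[R]_p) : Prop :=
  vnorm u = 1 /\
  exists lam : R, A *m u = lam *: u /\
    (forall (mu : R) (w : 'cV[R]_p), w != 0 -> A *m w = mu *: w -> mu <= lam).

Definition zeta (tau c : R) : R :=
  4 * Num.sqrt c / tau * (1 + (2 + Num.sqrt c) / tau).

Definition std_normal_rv d (T : measurableType d) (P : probability T R)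
  (X : T -> R) : Prop :=
  measurable_fun setT X /\
  forall B : set R, measurable B -> P (X @^-1` B) = normal_prob 0 1 B.

Definition mutually_independent d (T : measurableType d) (P : probability T R)
  (I : eqType) (X : I -> T -> R) : Prop :=
  forall (s : seq I) (B : I -> set R), uniq s -> (forall i, measurable (B i)) ->
    P (\bigcap_(i in [set i | i \in s]) (X i @^-1` B i)) =
    (\prod_(i <- s) P (X i @^-1` B i))%E.

End defs.

(* Main.v *)
Require Import Defs.
From HB Require Import structures.
From mathcomp Require Import all_boot all_order all_algebra.
From mathcomp Require Import all_classical all_reals all_analysis.
From mathcomp Require Import measurable_realfun.
From mathcomp Require Import ring lra.
Import Order.TTheory GRing.Theory Num.Theory numFieldNormedType.Exports.
Set Implicit Arguments.
Unset Strict Implicit.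
Unset Printing Implicit Defensive.
Local Open Scope classical_set_scope.
Local Open Scope ring_scope.

(** Write [r] for the unit vector along [rho], [g^2 = |rho|^2 + sigma^2], [Z] for
    the noise matrix and [s = sqrt c]. Decomposing the top eigenvector as
    [C r + a] with [a] orthogonal to [r], the eigenvalue equation tested against
    [a] gives
      [sin angle <= |S r - (r^T S r) r| / (r^T S r - sigma^2 lambda_max (Z Z^T / n))].
    Since [zeta] exceeds the sharp asymptotic value of the right-hand side by a
    definite factor, crude Chernoff bounds suffice: almost surely
    - [r^T S r] is asymptotically at least [g^2];
    - [|S r - (r^T S r) r|] is asymptotically at most [(8/5) s sigma g]. Its
      square is linearised by averaging exponentials over random signs, and
      products of uncorrelated Gaussian forms are differences of squares;
    - [lambda_max (Z Z^T / n)] is asymptotically at most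
      [1 + (81/64) (2 sqrt 5 s + 10 s^2)], by a weighted union bound over a lattice
      and a rounding argument which uses that [Z Z^T / n - 1] has asymptotically
      nonnegative diagonal.
    All moments come from [E exp (t A) = exp (t^2 V / 2)] for linear forms [A]. *)

(** * Gaussian integrals *)

(** Every almost sure bound is proved in one form. A union bound is packed into a single nonnegative
    function [F n], a weighted sum of exponentials with summable expectation, so that almost surely
    [F n w < 1] eventually. At such a sample point every term is below 1, or, for the random signs,
    the whole sum is; the rest is deterministic algebra at fixed [w]. No supremum over vectors ever
    has to be measurable.

    The cross term shapes the rates. Linearising its square by signs produces factors [cosh (x j)],
    comparable with [exp (x j ^ 2 / 2)] only while [x j] is small. With [h = n^(1/4)] and
    exponential parameter [h / n], this smallness means that each coordinate is at most [3/10 h^3],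
    which a separate union bound supplies. Both steps fail with probability of order
    [exp (- k sqrt n)] up to a factor [n]; hence the rate [n exp (- k sqrt n)] to which all the
    other estimates are weakened. *)

Section gaussian_integrals.
Context {R : realType}.
Notation mu := (@lebesgue_measure R).

(** [normal_prob] is defined by its density, so its Radon-Nikodym derivative is [normal_pdf] almost
    everywhere; the change of variables along the derivative does the rest. *)
Lemma ge0_integral_normal_prob (m s : R) (f : R -> \bar R) :
  measurable_fun setT f -> (forall x, 0 <= f x)%E ->
  (\int[normal_prob m s]_x f x = \int[mu]_x (f x * (normal_pdf m s x)%:E))%E.
Proof.
move=> mf f0.
have dom : (normal_prob m s : {finite_measure set (measurableTypeR R) -> \bar R}) `<< mu.
  exact: normal_prob_dominates.
rewrite -(Radon_Nikodym_SigmaFinite.change_of_variables dom)//.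
have mRN := measurable_int _ (Radon_Nikodym_SigmaFinite.f_integrable dom).
have mpdf : measurable_fun setT (fun x => (normal_pdf m s x)%:E).
  by apply/measurable_EFinP; exact: measurable_normal_pdf.
apply: ae_eq_integral => //.
- exact: emeasurable_funM.
- exact: emeasurable_funM.
- apply: ae_eqe_mul2l.
  apply: integral_ae_eq => //.
  + exact: Radon_Nikodym_SigmaFinite.f_integrable.
  + by move=> E _ mE; rewrite -(Radon_Nikodym_SigmaFinite.f_integral dom).
Qed.

(** Completing the square: [exp (t x)] times the standard density is [exp (t^2 / 2)] times the
    density with mean [t]. *)
Lemma integral_normal_prob_expR (t : R) :
  (\int[normal_prob 0 1]_x (expR (t * x))%:E = (expR (t ^+ 2 / 2))%:E)%E.
Proof.
have mexp : measurable_fun setT (fun x : R => (expR (t * x))%:E).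
  by apply/measurable_EFinP; exact: measurableT_comp.
rewrite ge0_integral_normal_prob//.
transitivity (\int[mu]_x ((expR (t ^+ 2 / 2))%:E * (normal_pdf t 1 x)%:E))%E.
  apply: eq_integral => x _; rewrite -!EFinM; congr EFin.
  rewrite !normal_pdfE ?oner_eq0// mulrCA [RHS]mulrCA; congr (_ * _).
  by rewrite /normal_fun -!expRD; congr expR; field.
rewrite (@ge0_integralZl _ _ R mu _ measurableT (fun x => (normal_pdf t 1 x)%:E)).
- by rewrite integral_normal_pdf mule1.
- by apply/measurable_EFinP; exact: measurable_normal_pdf.
- by move=> x _; rewrite lee_fin normal_pdf_ge0.
- by rewrite lee_fin expR_ge0.
Qed.

(** The integrand times the standard density is [s] times the centred normal density of standard
    deviation [s = (1 - 2 t)^(-1/2)]. *)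
Lemma integral_normal_prob_expR_sqr (t : R) : 2 * t < 1 ->
  (\int[normal_prob 0 1]_x (expR (t * x ^+ 2))%:E
     = ((Num.sqrt (1 - 2 * t))^-1)%:E)%E.
Proof.
move=> t1.
have mexp : measurable_fun setT (fun x : R => (expR (t * x ^+ 2))%:E).
  apply/measurable_EFinP; apply: measurableT_comp => //.
  by apply: measurable_funM => //; exact: measurable_funX.
rewrite ge0_integral_normal_prob//.
set s := (Num.sqrt (1 - 2 * t))^-1.
have t0 : 0 < 1 - 2 * t by lra.
have s0 : 0 < s by rewrite invr_gt0 sqrtr_gt0.
have s2 : s ^+ 2 = (1 - 2 * t)^-1 by rewrite exprVn sqr_sqrtr// ltW.
transitivity (\int[mu]_x (s%:E * (normal_pdf 0 s x)%:E))%E.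
  apply: eq_integral => x _; rewrite -!EFinM; congr EFin.
  rewrite !normal_pdfE ?oner_eq0 ?gt_eqF// mulrCA [RHS]mulrA; congr (_ * _).
    rewrite /normal_peak expr1n mul1r -mulrnAr sqrtrM ?sqr_ge0// sqrtr_sqr.
    by rewrite gtr0_norm// invfM mulrA divff ?gt_eqF// mul1r.
  rewrite /normal_fun -!expRD s2; congr expR; field.
  exact: lt0r_neq0.
rewrite (@ge0_integralZl _ _ R mu _ measurableT (fun x => (normal_pdf 0 s x)%:E)).
- by rewrite integral_normal_pdf mule1.
- by apply/measurable_EFinP; exact: measurable_normal_pdf.
- by move=> x _; rewrite lee_fin normal_pdf_ge0.
- by rewrite lee_fin ltW.
Qed.

End gaussian_integrals.

(** * Independence *)

Section independence.
Context {R : realType} {d : measure_display} {T : measurableType d}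
  (P : probability T R) {I : eqType} (X : I -> T -> R).
Hypothesis mX : forall i, measurable_fun setT (X i).
Hypothesis indX : mutually_independent P X.

(** A pi-system generating the sigma-algebra of the coordinates indexed by [K]. Lists may repeat
    indices, so that intersecting amounts to concatenating; [undup] restores the duplicate-free
    lists that [mutually_independent] speaks of. *)
Definition cylinders (K : set I) : set (set T) :=
  [set A | exists (s : seq I) (B : I -> set R),
     [/\ forall i, i \in s -> K i, forall i, measurable (B i) &
         A = \bigcap_(i in [set i | i \in s]) (X i @^-1` B i)]].

Definition sub_measurable (K : set I) (f : T -> R) :=
  @measurable_fun _ _ (g_sigma_algebraType (cylinders K)) R setT f.

Lemma cylinders_measurable K : cylinders K `<=` measurable.
Proof.
move=> _ [s [B [_ mB ->]]].
elim: s => [|i s IH].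
  by rewrite [X in measurable X](_ : _ = setT)//; apply/seteqP; split.
rewrite [X in measurable X](_ : _ = X i @^-1` B i `&`
    \bigcap_(i in [set i | i \in s]) (X i @^-1` B i)).
  by apply: measurableI => //; rewrite -[_ @^-1` _]setTI; exact: mX.
apply/seteqP; split => w /=.
  move=> H; split; first by apply: (H i); rewrite /= mem_head.
  by move=> j /= js; apply: (H j); rewrite /= inE js orbT.
by move=> [Hi H] j /=; rewrite inE => /predU1P[->|/H].
Qed.

Lemma cylindersT K : cylinders K setT.
Proof.
exists [::], (fun=> setT); split => //.
by apply/seteqP; split.
Qed.

Lemma cylinders_setI K : setI_closed (cylinders K).
Proof.
move=> _ _ [s [B [sK mB ->]]] [s' [B' [s'K mB' ->]]].
exists (s ++ s'), (fun i => (if i \in s then B i else setT) `&`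
                           (if i \in s' then B' i else setT)); split.
- by move=> i; rewrite mem_cat => /orP[/sK|/s'K].
- by move=> i; apply: measurableI; case: ifP.
- apply/seteqP; split => w /=.
    move=> [Bw B'w] i /= _; split; case: ifPn => // si;
      by [exact: Bw | exact: B'w].
  move=> H; split => i /= si.
    by have := H i; rewrite /= mem_cat si => /(_ isT)[].
  by have := H i; rewrite /= mem_cat si orbT => /(_ isT)[].
Qed.

Lemma cylinders_prob (s : seq I) (B : I -> set R) :
  (forall i, measurable (B i)) ->
  P (\bigcap_(i in [set i | i \in s]) (X i @^-1` B i)) =
  (\prod_(i <- undup s) P (X i @^-1` B i))%E.
Proof.
move=> mB; rewrite -(indX (undup_uniq s) mB); congr (P _).
by apply: eq_bigcapl; split=> i; rewrite /= mem_undup.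
Qed.

Lemma cylinders_indep K L A B : K `&` L = set0 ->
  cylinders K A -> cylinders L B -> (P (A `&` B) = P A * P B)%E.
Proof.
move=> KL [s [B1 [sK mB1 ->]]] [s' [B2 [s'L mB2 ->]]].
pose s1 := undup s; pose s2 := undup s'.
(* The two lists are disjoint, so one family [C] serves both and independence applies once, to their
   concatenation. *)
pose C i := if i \in s then B1 i else B2 i.
have disj i : i \in s' -> i \notin s.
  move=> si'; apply/negP => si; have : (K `&` L) i by split; [exact: sK|exact: s'L].
  by rewrite KL.
have mC i : measurable (C i) by rewrite /C; case: ifP.
have e1 : (\prod_(i <- undup s) P (X i @^-1` B1 i) =
           \prod_(i <- undup s) P (X i @^-1` C i))%E.
  by apply: eq_big_seq => i; rewrite mem_undup /C => ->.
have e2 : (\prod_(i <- undup s') P (X i @^-1` B2 i) =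
           \prod_(i <- undup s') P (X i @^-1` C i))%E.
  by apply: eq_big_seq => i; rewrite mem_undup /C => /disj /negbTE ->.
rewrite !cylinders_prob// e1 e2.
rewrite -big_cat -indX//; last first.
  rewrite cat_uniq !undup_uniq/= andbT; apply/hasPn => i.
  by rewrite !mem_undup => /disj.
congr (P _); apply/seteqP; split => w /=.
  move=> [H1 H2] i /=; rewrite mem_cat !mem_undup /C.
  by case: ifPn => si => [_|/= si']; [exact: H1|exact: H2].
move=> H; split => i /= si; have := H i; rewrite /= mem_cat !mem_undup /C.
  by rewrite si => /(_ isT).
by rewrite si orbT (negbTE (disj _ si)) => /(_ isT).
Qed.

Lemma sub_measurable_set K A : <<s cylinders K >> A -> measurable A.
Proof.
exact: (smallest_sub (@sigma_algebra_measurable _ T) (@cylinders_measurable K)).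
Qed.

(** Both sides are finite measures in [A] agreeing on the pi-system [G]. Used once in each argument,
    this lifts independence from cylinders to the generated sigma-algebras. *)
Lemma sigma_indep_ext (G : set (set T)) (B : set T) : G `<=` measurable ->
  setI_closed G -> G setT -> measurable B ->
  (forall A, G A -> P (A `&` B) = P A * P B)%E ->
  forall A, <<s G >> A -> (P (A `&` B) = P A * P B)%E.
Proof.
move=> Gm GI GT mB H A sA.
have PB0 : 0 <= fine (P B) by exact: fine_ge0.
pose m2 := mscale (NngNum PB0) P.
have m2E C : m2 C = (P C * P B)%E.
  by rewrite /m2 /mscale/= fineK ?fin_num_measure// muleC.
rewrite -m2E -/(mrestr P mB A).
apply: (g_sigma_algebra_measure_unique G Gm (fun=> setT)) => //.
- by rewrite bigcup_const.
- by move=> C GC; rewrite /= /mrestr H.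
- by move=> _; rewrite /= /mrestr setTI -ge0_fin_numE// fin_num_measure.
Qed.

Lemma sigma_indep K L A B : K `&` L = set0 ->
  <<s cylinders K >> A -> <<s cylinders L >> B -> (P (A `&` B) = P A * P B)%E.
Proof.
move=> KL sA sB; have mB := sub_measurable_set sB.
move: A sA; apply: sigma_indep_ext => //.
- exact: cylinders_measurable.
- exact: cylinders_setI.
- exact: cylindersT.
move=> A cA; have mA := cylinders_measurable cA.
rewrite setIC muleC; move: B sB {mB}; apply: sigma_indep_ext => //.
- exact: cylinders_measurable.
- exact: cylinders_setI.
- exact: cylindersT.
by move=> B cB; rewrite setIC muleC; exact: cylinders_indep cA cB.
Qed.

Lemma sub_measurableW K f : sub_measurable K f -> measurable_fun setT f.
Proof.
by move=> mf _ B mB; apply: (@sub_measurable_set K); exact: (mf measurableT B mB).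
Qed.

Lemma sub_measurable_coord (K : set I) i : K i -> sub_measurable K (X i).
Proof.
move=> Ki _ B mB; rewrite setTI; apply: sub_sigma_algebra.
exists [:: i], (fun=> B); split => //.
- by move=> j; rewrite inE => /eqP ->.
- apply/seteqP; split => w /=; first by move=> Bw j /=; rewrite inE => /eqP ->.
  by apply; rewrite /= inE.
Qed.

Lemma sub_measurableS K L f : K `<=` L -> sub_measurable K f -> sub_measurable L f.
Proof.
move=> KL mf _ B mB; have := mf measurableT B mB.
apply: sub_sigma_algebra2 => A [s [C [sK mC ->]]].
by exists s, C; split => // i /sK /KL.
Qed.

(** The law of [(f, g)] factorises on rectangles, hence is the product law; Tonelli then splits the
    integral. *)
Lemma expectation_mul_indep K L (f g : T -> R) : K `&` L = set0 ->
  sub_measurable K f -> sub_measurable L g ->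
  (forall w, 0 <= f w) -> (forall w, 0 <= g w) ->
  (\int[P]_w (f w * g w)%:E = \int[P]_w (f w)%:E * \int[P]_w (g w)%:E)%E.
Proof.
move=> KL mf mg f0 g0.
have mf' := sub_measurableW mf; have mg' := sub_measurableW mg.
have mfg : measurable_fun setT (fun w => (f w, g w)) by exact: measurable_fun_pair.
pose Pf := pushforward P f; pose Pg := pushforward P g.
pose Pfg := pushforward P (fun w => (f w, g w)).
pose mF : {mfun T >-> R} := HB.pack f (isMeasurableFun.Build _ _ _ _ _ mf').
pose mG : {mfun T >-> R} := HB.pack g (isMeasurableFun.Build _ _ _ _ _ mg').
pose mFG : {mfun T >-> (R * R)%type} :=
  HB.pack (fun w => (f w, g w)) (isMeasurableFun.Build _ _ _ _ _ mfg).
have prodE A : measurable A ->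
   (distribution P mF \x distribution P mG)%E A = distribution P mFG A.
  apply: product_measure_unique => B C mB mC /=.
  rewrite /distribution /pushforward /=.
  have sB : <<s cylinders K >> (f @^-1` B).
    by rewrite -[_ @^-1` _]setTI; exact: mf.
  have sC : <<s cylinders L >> (g @^-1` C).
    by rewrite -[_ @^-1` _]setTI; exact: mg.
  by rewrite -(sigma_indep KL sB sC).
(* Absolute values make the integrand nonnegative on the whole plane and change nothing on the range
   of [(f, g)]. *)
pose h (z : R * R) : \bar R := (`|z.1| * `|z.2|)%:E.
have mh : measurable_fun setT h.
  apply/measurable_EFinP; apply: measurable_funM; apply: measurableT_comp => //.
transitivity (\int[distribution P mFG]_z h z)%E.
  rewrite ge0_integral_distribution//; last first.
    by move=> z; rewrite lee_fin mulr_ge0.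
  by apply: eq_integral => w _; rewrite /h /= !ger0_norm.
transitivity (\int[distribution P mF \x distribution P mG]_z h z)%E.
  by apply: eq_measure_integral => A mA _; apply/esym; exact: prodE.
rewrite fubini_tonelli1//; last by move=> z; rewrite lee_fin mulr_ge0.
rewrite /fubini_F /h /=.
have abs_meas : measurable_fun setT (fun x : R => (`|x|)%:E).
  by apply/measurable_EFinP; exact: normr_measurable.
transitivity (\int[distribution P mF]_x
  ((`|x|)%:E * \int[distribution P mG]_y (`|y|)%:E))%E.
  apply: eq_integral => x _; under eq_integral do rewrite EFinM.
  by rewrite ge0_integralZl// ?lee_fin.
rewrite ge0_integralZr//; last exact: integral_ge0.
congr (_ * _)%E; rewrite ge0_integral_distribution//;
  by apply: eq_integral => w _ /=; rewrite ger0_norm.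
Qed.

Lemma expectation_prod_indep (J : eqType) (s : seq J) (K : J -> set I)
    (f : J -> T -> R) : uniq s ->
  (forall i j, i != j -> K i `&` K j = set0) ->
  (forall j, sub_measurable (K j) (f j)) -> (forall j w, 0 <= f j w) ->
  (\int[P]_w (\prod_(j <- s) f j w)%:E = \prod_(j <- s) \int[P]_w (f j w)%:E)%E.
Proof.
move=> + KK mf f0; elim: s => [_|j s IH /= /andP[js us]].
  under eq_integral do rewrite big_nil.
  by rewrite (integral_cst P measurableT 1) big_nil mul1e; exact: probability_setT.
rewrite big_cons -(IH us).
under eq_integral do rewrite big_cons.
apply: (@expectation_mul_indep (K j) (\bigcup_(i in [set i | i \in s]) K i)) => //.
- rewrite setI_bigcupr; apply: bigcup0 => i /= si; apply: KK.
  by apply: contraNN js => /eqP ->.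
- apply: measurable_prod => i si.
  by apply: sub_measurableS (mf i) => k Kk; exists i.
- by move=> w; exact: prodr_ge0.
Qed.

End independence.

(** * Exponential inequalities and moments of Gaussian forms *)

Section exponential_inequalities.
Context {R : realType}.
Implicit Types x y u : R.

Lemma expR_ge_quadratic x : 0 <= x -> 1 + x + x ^+ 2 / 2 <= expR x.
Proof.
move=> x0; have -> : 1 + x + x ^+ 2 / 2 = series (exp_coeff x) 3.
  by rewrite /series /exp_coeff /= !big_nat_recr//= big_nil !factS fact0; field.
apply: nondecreasing_cvgn_le; last exact: is_cvg_series_exp_coeff.
apply/nondecreasing_seqP => n; rewrite /series /= big_nat_recr//= lerDl.
exact: exp_coeff_ge0.
Qed.

(** Inverts [expR_ge_quadratic], since [(1 + x + x^2 / 2) (1 - x + x^2 / 2) = 1 + x^4 / 4]. *)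
Lemma expRN_le_quadratic x : 0 <= x -> expR (- x) <= 1 - x + x ^+ 2 / 2.
Proof.
move=> x0; rewrite -(ler_pM2l (expR_gt0 x)) expRxMexpNx_1.
have q0 : 0 <= 1 - x + x ^+ 2 / 2.
  have -> : 1 - x + x ^+ 2 / 2 = ((1 - x) ^+ 2 + 1) / 2 by field.
  by rewrite divr_ge0// addr_ge0// sqr_ge0.
apply: le_trans (ler_wpM2r q0 (expR_ge_quadratic x0)).
have -> : (1 + x + x ^+ 2 / 2) * (1 - x + x ^+ 2 / 2) = 1 + x ^+ 4 / 4 by field.
by rewrite lerDl mulr_ge0// exprn_even_ge0.
Qed.

Lemma expR_le_quadratic x : 0 <= x -> expR x <= 1 + x + x ^+ 2 * expR x.
Proof.
move=> x0; have e := expRxMexpNx_1 x.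
have h := expR_ge1Dx (- x); have ex := expR_gt0 x.
have : expR x * (1 - x) <= 1 by rewrite -[leRHS]e ler_pM2l.
by nra.
Qed.

Lemma sinh_ge x : 0 <= x -> 2 * x <= expR x - expR (- x).
Proof.
by move=> x0; have := expR_ge_quadratic x0; have := expRN_le_quadratic x0; lra.
Qed.

(** [2 cosh x - 2] is the square of [2 sinh (x / 2)], whose absolute value is at least that of
    [x]. *)
Lemma cosh_ge x : 2 + x ^+ 2 <= expR x + expR (- x).
Proof.
wlog x0 : x / 0 <= x => [h|].
  have [/h//|x0] := leP 0 x; have := h (- x); rewrite sqrrN opprK.
  by rewrite [in X in _ -> X](addrC (expR x)); apply; lra.
have h : 2 * (x / 2) <= expR (x / 2) - expR (- (x / 2)) by apply: sinh_ge; lra.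
have e1 : expR x = expR (x / 2) ^+ 2 by rewrite -expRM_natl; congr expR; field.
have e2 : expR (- x) = expR (- (x / 2)) ^+ 2 by rewrite -expRM_natl; congr expR; field.
have e3 := expRxMexpNx_1 (x / 2).
rewrite e1 e2; nra.
Qed.

(** This is [sinh l >= l] at [l = ln y]. *)
Lemma le_expR_half_subV y : 1 <= y -> y <= expR ((y - y^-1) / 2).
Proof.
move=> y1; have y0 : 0 < y by lra.
rewrite -{1}(@lnK _ y) ?posrE// ler_expR.
have := sinh_ge (ln_ge0 y1); rewrite expRN lnK ?posrE//; lra.
Qed.

(** At [x = c sqrt n] the sixth power is of order [n^3], which makes [n exp (- c sqrt n)] of order
    [n^(-2)], hence summable. *)
Lemma expR_sixth_power_le x : 0 <= x -> (x / 6) ^+ 6 <= expR x.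
Proof.
move=> x0; have -> : expR x = expR (x / 6) ^+ 6.
  by rewrite -expRM_natl; congr expR; field.
by apply: lerXn2r; rewrite ?nnegrE ?expR_ge0//; [lra|have := expR_ge1Dx (x / 6); lra].
Qed.

Lemma expR_le1D y : 0 <= y -> y <= 1 / 20 -> expR (19 / 20 * y) <= 1 + y.
Proof.
move=> y0 y1; have h := expR_ge1Dx (- (19 / 20 * y)).
have e := expRxMexpNx_1 (19 / 20 * y); have ex := expR_gt0 (19 / 20 * y).
have : expR (19 / 20 * y) * (1 + - (19 / 20 * y)) <= 1 by rewrite -[leRHS]e ler_pM2l.
move=> H; have : expR (19 / 20 * y) * (1 + - (19 / 20 * y)) <=
  (1 + y) * (1 + - (19 / 20 * y)) by apply: le_trans H _; nra.
by rewrite ler_pM2r//; lra.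
Qed.

(** The logarithm of the left-hand side is [u + u^2 + ...]; the coefficient [6/5] leaves room for
    the higher orders. *)
Lemma invsqrt_le_expR u : 0 <= u -> u <= 1 / 40 ->
  (Num.sqrt (1 - 2 * u))^-1 <= expR (u + 6 / 5 * u ^+ 2).
Proof.
move=> u0 u1; have h : 0 < 1 - 2 * u by lra.
rewrite -[leRHS]invrK lef_pV2 ?posrE ?invr_gt0 ?expR_gt0 ?sqrtr_gt0//.
rewrite -expRN -[leLHS]gtr0_norm ?expR_gt0// -sqrtr_sqr ler_sqrt//; last exact: ltW.
rewrite -expRM_natl.
have -> : 2%:R * - (u + 6 / 5 * u ^+ 2) = - (2 * u + 12 / 5 * u ^+ 2) by field.
apply: le_trans (expRN_le_quadratic _) _; nra.
Qed.

Lemma quadratic_le_expR u : 0 <= u -> u <= 1 / 40 ->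
  1 - u + 31 / 20 * u ^+ 2 <= expR (- u + 6 / 5 * u ^+ 2).
Proof.
move=> u0 u1; set z := u - 6 / 5 * u ^+ 2.
have z0 : 0 <= z by rewrite /z; nra.
have zu : z <= u by rewrite /z; nra.
have -> : - u + 6 / 5 * u ^+ 2 = 4%:R * - (z / 4) by rewrite /z; field.
rewrite expRM_natl.
(* The fourth power has quadratic coefficient [3/8], and [3/8 + 6/5] exceeds [31/20]; with lower
   powers the second order would not suffice. *)
apply: (@le_trans _ _ ((1 + - (z / 4)) ^+ 4)); last first.
  by apply: lerXn2r; rewrite ?nnegrE ?expR_ge0 ?expR_ge1Dx//; lra.
have -> : (1 + - (z / 4)) ^+ 4 = 1 - z + 3 / 8 * z ^+ 2 - z ^+ 3 / 16 + z ^+ 4 / 256 by field.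
have z3 : z ^+ 3 <= u ^+ 3 by apply: lerXn2r.
have z4 : 0 <= z ^+ 4 by exact: exprn_ge0.
have z2 : u ^+ 2 - 12 / 5 * u ^+ 3 <= z ^+ 2.
  by rewrite /z; have : 0 <= u ^+ 4 by [exact: exprn_ge0]; nra.
have u3 : u ^+ 3 <= u ^+ 2 / 40 by nra.
rewrite {1}/z; nra.
Qed.

End exponential_inequalities.

(** * Moment generating functions of squares and products of Gaussian forms *)

Section gaussian_forms.
Context {R : realType} {d : measure_display} {T : measurableType d}
  (P : probability T R).
Implicit Types (A B : T -> R) (V t : R).

(* Gaussianity of variance V is only ever used through the moment generating
   function; in particular V = 0 is allowed. *)
Definition gaussian_mgf A V := measurable_fun setT A /\
  forall t, (\int[P]_w (expR (t * A w))%:E = (expR (t ^+ 2 * V / 2))%:E)%E.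

Lemma gaussian_mgfZ A V c : gaussian_mgf A V ->
  gaussian_mgf (fun w => c * A w) (c ^+ 2 * V).
Proof.
move=> [mA hA]; split; first exact: measurable_funM.
move=> t; have := hA (t * c).
under eq_integral do rewrite -mulrA.
by move=> ->; rewrite exprMn mulrA.
Qed.

Lemma measurable_expRMX (A : T -> R) t n : measurable_fun setT A ->
  measurable_fun setT (fun w => (expR (t * A w ^+ n))%:E).
Proof.
move=> mA; apply/measurable_EFinP; apply: measurableT_comp => //.
by apply: measurable_funM => //; exact: measurable_funX.
Qed.

(* Linearising the square with an auxiliary Gaussian variable:
   exp (t A^2) is the normal average of exp (sqrt (2 t) A y). *)
Lemma integral_expR_sqr A V t : gaussian_mgf A V -> 0 <= t -> 2 * (t * V) < 1 ->
  (\int[P]_w (expR (t * A w ^+ 2))%:E = ((Num.sqrt (1 - 2 * (t * V)))^-1)%:E)%E.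
Proof.
move=> [mA hA] t0 tV; set r := Num.sqrt (2 * t).
have r2 : r ^+ 2 = 2 * t by rewrite sqr_sqrtr//; lra.
pose f (z : T * R) : \bar R := (expR (r * A z.1 * z.2))%:E.
have mf : measurable_fun setT f.
  apply/measurable_EFinP; apply: measurableT_comp => //.
  apply: measurable_funM => //; apply: measurable_funM => //.
  exact: measurableT_comp.
transitivity (\int[P]_w \int[normal_prob 0 1]_y f (w, y))%E.
  apply: eq_integral => w _; rewrite /f /= integral_normal_prob_expR.
  by congr (expR _)%:E; rewrite exprMn r2; field.
transitivity (\int[normal_prob 0 1]_y \int[P]_w f (w, y))%E.
  have f0 z : (0 <= f z)%E by rewrite lee_fin expR_ge0.
  exact: (@fubini_tonelli _ _ T _ R P (normal_prob 0 1) f mf f0).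
rewrite -(integral_normal_prob_expR_sqr tV); apply: eq_integral => y _.
rewrite /f /=; have := hA (r * y).
under eq_integral do rewrite mulrAC.
by move=> ->; congr (expR _)%:E; rewrite exprMn r2; field.
Qed.

Lemma integral_expR_sqr1 A t : gaussian_mgf A 1 -> 0 <= t -> 2 * t < 1 ->
  (\int[P]_w (expR (t * A w ^+ 2))%:E = ((Num.sqrt (1 - 2 * t))^-1)%:E)%E.
Proof. by move=> gA t0 t1; rewrite (integral_expR_sqr gA)// mulr1. Qed.

Section unit_moments.
Variable A : T -> R.
Hypothesis gA : gaussian_mgf A 1.
Let mA : measurable_fun setT A := proj1 gA.
Let M2 := (\int[P]_w (A w ^+ 2)%:E)%E.
Let M4 := (\int[P]_w (A w ^+ 4)%:E)%E.

Let mX n : measurable_fun setT (fun w => (A w ^+ n)%:E).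
Proof. by apply/measurable_EFinP; exact: measurable_funX. Qed.

Let X4 w : 0 <= A w ^+ 4. Proof. exact: exprn_even_ge0. Qed.

(** Integrates the quadratic lower bound of [exp (t A^2)]. Its case [t = 1 / 4] makes both moments
    finite. *)
Let moments_le t : 0 <= t -> 2 * t < 1 ->
  (1 + t%:E * M2 + (t ^+ 2 / 2)%:E * M4 <= ((Num.sqrt (1 - 2 * t))^-1)%:E)%E.
Proof.
move=> t0 t1; rewrite -(integral_expR_sqr1 gA t0 t1) /M2 /M4.
have t20 : 0 <= t ^+ 2 / 2 by rewrite divr_ge0// sqr_ge0.
rewrite -(probability_setT P) -[X in (X + _ + _)%E]mul1e -(integral_cst P measurableT 1).
rewrite -!ge0_integralZl//; try by [move=> w _; rewrite lee_fin ?sqr_ge0].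
rewrite -!ge0_integralD//.
- apply: ge0_le_integral => //.
  + move=> w _; rewrite !adde_ge0// mule_ge0// lee_fin ?sqr_ge0//.
  + apply: emeasurable_funD; last exact: emeasurable_funM.
    by apply: emeasurable_funD => //; exact: emeasurable_funM.
  + exact: measurable_expRMX.
  + move=> w _; rewrite -!EFinM -!EFinD lee_fin.
    have := @expR_ge_quadratic R (t * A w ^+ 2).
    rewrite mulr_ge0 ?sqr_ge0// => /(_ isT) h; apply: le_trans h.
    by rewrite exprMn -exprM; lra.
- by move=> w _; rewrite adde_ge0// mule_ge0// lee_fin sqr_ge0.
- by apply: emeasurable_funD => //; exact: emeasurable_funM.
- by move=> w _; rewrite mule_ge0// lee_fin.
- exact: emeasurable_funM.
- by move=> w _; rewrite mule_ge0// lee_fin sqr_ge0.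
- exact: emeasurable_funM.
Qed.

Let moments_fin : exists m2 m4 : R, [/\ M2 = m2%:E, M4 = m4%:E, 0 <= m2 & 0 <= m4].
Proof.
have M20 : (0 <= M2)%E by apply: integral_ge0 => w _; rewrite lee_fin sqr_ge0.
have M40 : (0 <= M4)%E by apply: integral_ge0 => w _; rewrite lee_fin.
have := @moments_le (1 / 4); rewrite divr_ge0// => /(_ isT).
have -> : 2 * (1 / 4) < 1 :> R by lra.
move=> /(_ isT); move: M2 M4 M20 M40.
case=> [m2| |]//; case=> [m4| |]// m20 m40.
- by exists m2, m4.
- by rewrite gt0_muley ?lte_fin//; lra.
- by rewrite gt0_muley ?lte_fin//; lra.
- by rewrite !gt0_muley ?lte_fin//; lra.
Qed.

(** The remainder [y^2 exp (t y)] is dominated uniformly in [t] by [128 exp (y / 4)], which is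
    integrable: [y^2 <= 128 exp (y / 8)] and [t <= 1 / 8]. *)
Let expR_sqr_le t w : 0 <= t -> t <= 1 / 8 ->
  expR (t * A w ^+ 2) <= 1 + t * A w ^+ 2 + 128 * t ^+ 2 * expR (1 / 4 * A w ^+ 2).
Proof.
move=> t0 t1; set y := A w ^+ 2; have y0 : 0 <= y by exact: sqr_ge0.
apply: le_trans (expR_le_quadratic _) _; first exact: mulr_ge0.
have -> : 128 * t ^+ 2 * expR (1 / 4 * y) = t ^+ 2 * (128 * expR (1 / 4 * y)) by ring.
have -> : (t * y) ^+ 2 * expR (t * y) = t ^+ 2 * (y ^+ 2 * expR (t * y)) by ring.
rewrite lerD2l ler_wpM2l ?sqr_ge0//.
have y8 : y ^+ 2 <= 128 * expR (y / 8).
  have := @expR_ge_quadratic R (y / 8); rewrite divr_ge0// => /(_ isT).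
  by nra.
apply: (@le_trans _ _ (128 * expR (y / 8) * expR (t * y))).
  by rewrite ler_wpM2r ?expR_ge0.
by rewrite -mulrA -expRD ler_pM2l// ler_expR; nra.
Qed.

(** Compare [1 + t <= E exp (t A^2) <= 1 + t M2 + 256 t^2] for small [t], where [256] is [128] times
    the bound [2] for [E exp (A^2 / 4)]. *)
Let M2_ge1 : (1 <= M2)%E.
Proof.
have [m2 [m4 [eM2 eM4 m20 m40]]] := moments_fin; rewrite eM2 lee_fin.
have key t : 0 < t -> t <= 1 / 8 -> 1 - 256 * t <= m2.
  move=> t0 t1; have tt1 : 2 * t < 1 by lra.
  have := integral_expR_sqr1 gA (ltW t0) tt1 => E1.
  have q1 : 2 * (1 / 4) < 1 :> R by lra.
  have q0 : 0 <= 1 / 4 :> R by lra.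
  have E4 := integral_expR_sqr1 gA q0 q1.
  have : (\int[P]_w (expR (t * A w ^+ 2))%:E <= 1 + t%:E * M2 +
      (128 * t ^+ 2)%:E * \int[P]_w (expR (1 / 4 * A w ^+ 2))%:E)%E.
    have t20 : 0 <= 128 * t ^+ 2 by rewrite mulr_ge0// sqr_ge0.
    rewrite -(probability_setT P) -[X in (X + _ + _)%E]mul1e -(integral_cst P measurableT 1).
    have t0' := ltW t0.
    rewrite -!ge0_integralZl//; try exact: measurable_expRMX;
      try by move=> w _; rewrite lee_fin sqr_ge0.
    rewrite -!ge0_integralD//.
    - apply: ge0_le_integral => //.
      + exact: measurable_expRMX.
      + apply: emeasurable_funD; last by apply: emeasurable_funM => //; exact: measurable_expRMX.
        by apply: emeasurable_funD => //; exact: emeasurable_funM.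
      + by move=> w _; rewrite -!EFinM -!EFinD lee_fin; exact: expR_sqr_le.
    - by move=> w _; rewrite adde_ge0// mule_ge0// lee_fin sqr_ge0.
    - by apply: emeasurable_funD => //; exact: emeasurable_funM.
    - by move=> w _; rewrite mule_ge0// lee_fin.
    - by apply: emeasurable_funM => //; exact: measurable_expRMX.
    - by move=> w _; rewrite mule_ge0// lee_fin sqr_ge0.
    - exact: emeasurable_funM.
  rewrite E1 E4 eM2 -!EFinM -!EFinD lee_fin.
  have h1 : 1 + t <= (Num.sqrt (1 - 2 * t))^-1.
    have s0 : 0 < Num.sqrt (1 - 2 * t) by rewrite sqrtr_gt0; lra.
    have s2 : Num.sqrt (1 - 2 * t) ^+ 2 = 1 - 2 * t by rewrite sqr_sqrtr//; lra.
    rewrite -[leRHS]mul1r ler_pdivlMr//.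
    rewrite -(@ler_pXn2r _ 2)// ?nnegrE//; last by rewrite mulr_ge0//; lra.
    by rewrite exprMn s2 expr1n; nra.
  have h2 : (Num.sqrt (1 - 2 * (1 / 4)))^-1 <= 2 :> R.
    have -> : (2 : R) = (2^-1)^-1 by rewrite invrK.
    rewrite lef_pV2 ?posrE ?sqrtr_gt0//; [|lra..].
    rewrite -[leLHS]ger0_norm ?invr_ge0// -sqrtr_sqr ler_sqrt; lra.
  by nra.
have [//|m21] := leP 1 m2.
have := key (Num.min (1 / 8) ((1 - m2) / 512)).
rewrite lt_min ge_min lexx => /= h.
have {}h : 1 - 256 * Num.min (1 / 8) ((1 - m2) / 512) <= m2 by apply: h => //; lra.
have : Num.min (1 / 8) ((1 - m2) / 512) <= (1 - m2) / 512 by rewrite ge_min lexx orbT.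
by lra.
Qed.

(** The exact value is 3. At [t = 1 / 100], [moments_le] and [M2 >= 1] leave [M4 / 2 <= 31 / 20],
    where [31 / 20] is the Taylor coefficient [3 / 2] of [(1 - 2 t)^(-1/2)] enlarged to absorb the
    higher orders. *)
Let M4_le : (M4 <= (31 / 10)%:E)%E.
Proof.
have [m2 [m4 [eM2 eM4 m20 m40]]] := moments_fin.
move: M2_ge1; rewrite eM2 eM4 !lee_fin => m21.
have h : 0 <= 1 / 100 :> R by lra.
have h' : 2 * (1 / 100) < 1 :> R by lra.
have := moments_le h h'; rewrite eM2 eM4 -!EFinM -!EFinD lee_fin.
set q : R := 1 + 1 / 100 + 31 / 20 * (1 / 100) ^+ 2.
have q0 : 0 < q by rewrite /q; lra.
have : (Num.sqrt (1 - 2 * (1 / 100)))^-1 <= q.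
  rewrite -[leRHS]invrK lef_pV2 ?posrE ?invr_gt0 ?sqrtr_gt0//; last lra.
  have qi : 0 <= q^-1 by rewrite invr_ge0 ltW.
  rewrite -[leLHS](ger0_norm qi) -sqrtr_sqr ler_sqrt; last lra.
  by rewrite exprVn -[leLHS]mul1r ler_pdivrMr ?exprn_gt0// /q; lra.
rewrite /q.
by lra.
Qed.

Lemma integral_expRN_sqr1 t : 0 <= t ->
  (\int[P]_w (expR (- t * A w ^+ 2))%:E <= (1 - t + 31 / 20 * t ^+ 2)%:E)%E.
Proof.
move=> t0; have [m2 [m4 [eM2 eM4 m20 m40]]] := moments_fin.
move: M2_ge1 M4_le; rewrite eM2 eM4 !lee_fin => m21 m43.
have t20 : 0 <= t ^+ 2 / 2 by rewrite divr_ge0// sqr_ge0.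
(* The term [t M2] stays on the left so that only nonnegative integrands occur. *)
have : (\int[P]_w (expR (- t * A w ^+ 2))%:E + t%:E * M2 <=
        1 + (t ^+ 2 / 2)%:E * M4)%E.
  rewrite -(probability_setT P) -[X in (_ <= X + _)%E]mul1e -(integral_cst P measurableT 1).
  rewrite /M2 /M4 -!ge0_integralZl//; try exact: mX;
    try by move=> w _; rewrite lee_fin ?X4 ?sqr_ge0.
  rewrite -!ge0_integralD//.
  - apply: ge0_le_integral => //.
    + by move=> w _; rewrite adde_ge0// mule_ge0// lee_fin sqr_ge0.
    + apply: emeasurable_funD; first exact: measurable_expRMX.
      exact: emeasurable_funM.
    + by apply: emeasurable_funD => //; exact: emeasurable_funM.
    + move=> w _; rewrite -!EFinM -!EFinD lee_fin.
      have := @expRN_le_quadratic R (t * A w ^+ 2).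
      rewrite mulr_ge0 ?sqr_ge0// => /(_ isT); rewrite exprMn -exprM mulNr; lra.
  - by move=> w _; rewrite mule_ge0// lee_fin.
  - exact: emeasurable_funM.
  - exact: measurable_expRMX.
  - by move=> w _; rewrite mule_ge0// lee_fin sqr_ge0.
  - exact: emeasurable_funM.
have I0 : (0 <= \int[P]_w (expR (- t * A w ^+ 2))%:E)%E.
  by apply: integral_ge0 => w _; rewrite lee_fin expR_ge0.
rewrite eM2 eM4; case: (\int[P]_w _)%E I0 => [i| |]// _.
by rewrite -!EFinM -!EFinD !lee_fin; nra.
Qed.

End unit_moments.

Lemma integral_expRN_sqr A V t : gaussian_mgf A V -> 0 < V -> 0 <= t ->
  (\int[P]_w (expR (- t * A w ^+ 2))%:E <=
   (1 - t * V + 31 / 20 * (t * V) ^+ 2)%:E)%E.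
Proof.
move=> gA V0 t0.
have gB := gaussian_mgfZ (Num.sqrt V)^-1 gA.
rewrite exprVn sqr_sqrtr ?ltW// mulVf ?gt_eqF// in gB.
have := integral_expRN_sqr1 gB (mulr_ge0 t0 (ltW V0)).
under eq_integral do rewrite exprMn exprVn sqr_sqrtr ?ltW// mulrA -mulNr mulfK ?gt_eqF//.
by [].
Qed.

(* theta A B = (theta / 4) (U^2 - D^2); AM-GM separates the two exponentials. *)
Lemma integral_expR_mul A B (U D : T -> R) V theta : 0 < V -> 0 <= theta ->
  theta * V / 2 <= 1 / 40 ->
  (forall w, 4 * (A w * B w) = U w ^+ 2 - D w ^+ 2) ->
  gaussian_mgf U V -> gaussian_mgf D V ->
  (\int[P]_w (expR (theta * (A w * B w)))%:E <=
   (expR (6 / 5 * (theta * V / 2) ^+ 2))%:E)%E.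
Proof.
move=> V0 th0; set u := theta * V / 2 => u40 UD gU gD.
have u0 : 0 <= u by rewrite /u divr_ge0// mulr_ge0// ltW.
have [mU _] := gU; have [mD _] := gD.
have a0 : 0 <= expR (- u) / 2 by rewrite divr_ge0 ?expR_ge0.
have b0 : 0 <= expR u / 2 by rewrite divr_ge0 ?expR_ge0.
(* The two integrals are close to [exp u] and [exp (- u)]; the weights [exp (- u)] and [exp u]
   cancel these first orders, so only the second order remains in the bound. *)
apply: (@le_trans _ _ ((expR (- u) / 2)%:E * \int[P]_w (expR (theta / 2 * U w ^+ 2))%:E
   + (expR u / 2)%:E * \int[P]_w (expR (- (theta / 2) * D w ^+ 2))%:E))%E.
  rewrite -!ge0_integralZl//; [|exact: measurable_expRMX..].
  rewrite -ge0_integralD//;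
    [|by apply: emeasurable_funM => //; exact: measurable_expRMX..].
  have ABE : (fun w => (expR (theta * (A w * B w)))%:E) =
     (fun w => (expR (theta / 4 * U w ^+ 2) * expR (- (theta / 4) * D w ^+ 2))%:E).
    apply/funext => w; rewrite -expRD; congr (expR _)%:E.
    by have := UD w; nra.
  rewrite ABE; apply: ge0_le_integral => //.
  - apply/measurable_EFinP; apply: measurable_funM;
      by apply/measurable_EFinP; exact: measurable_expRMX.
  - by apply: emeasurable_funD; apply: emeasurable_funM => //; exact: measurable_expRMX.
  - move=> w _; rewrite -!EFinM -EFinD lee_fin.
    set x := expR (theta / 4 * _); set y := expR (- (theta / 4) * _).
    have -> : expR (theta / 2 * U w ^+ 2) = x ^+ 2.
      by rewrite /x -expRM_natl; congr expR; field.
    have -> : expR (- (theta / 2) * D w ^+ 2) = y ^+ 2.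
      by rewrite /y -expRM_natl; congr expR; field.
    have e := expRxMexpNx_1 u.
    have e1 : expR (u / 2) ^+ 2 = expR u by rewrite -expRM_natl; congr expR; field.
    have e2 : expR (- (u / 2)) ^+ 2 = expR (- u) by rewrite -expRM_natl; congr expR; field.
    have e3 := expRxMexpNx_1 (u / 2).
    rewrite -e1 -e2.
    have := sqr_ge0 (expR (- (u / 2)) * x - expR (u / 2) * y).
    rewrite sqrrB !exprMn.
    have -> : expR (- (u / 2)) * x * (expR (u / 2) * y) =
      (expR (u / 2) * expR (- (u / 2))) * (x * y) by ring.
    rewrite e3 mul1r; lra.
have tU : 2 * (theta / 2 * V) < 1 by move: u40; rewrite /u; lra.
have th20 : 0 <= theta / 2 by lra.
have thu : theta / 2 * V = u by rewrite /u; field.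
rewrite (integral_expR_sqr gU th20 tU).
apply: (@le_trans _ _ ((expR (- u) / 2 * (Num.sqrt (1 - 2 * u))^-1 +
   expR u / 2 * (1 - u + 31 / 20 * u ^+ 2))%:E)).
  rewrite EFinD !EFinM -thu leeD2l// lee_pmul2l ?lte_fin ?divr_gt0 ?expR_gt0//.
  exact: integral_expRN_sqr.
rewrite lee_fin.
have h1 := invsqrt_le_expR u0 u40; have h2 := quadratic_le_expR u0 u40.
set E := expR (6 / 5 * u ^+ 2).
have -> : E = expR (- u) / 2 * expR (u + 6 / 5 * u ^+ 2) +
    expR u / 2 * expR (- u + 6 / 5 * u ^+ 2).
  rewrite !expRD -/E; have := expRxMexpNx_1 u => e.
  have -> : expR (- u) / 2 * (expR u * E) = (expR u * expR (- u)) * (E / 2) by field.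
  have -> : expR u / 2 * (expR (- u) * E) = (expR u * expR (- u)) * (E / 2) by field.
  by rewrite e; field.
by rewrite lerD// ler_wpM2l.
Qed.

End gaussian_forms.

(** * Almost sure bounds from summable expectations *)

Section borel_cantelli.
Context {R : realType} {d : measure_display} {T : measurableType d}
  (P : probability T R).

Lemma sum_telescope_le1 (n : nat) :
  \sum_(0 <= i < n) ((i.+1%:R * i.+2%:R)^-1 : R) <= 1.
Proof.
suff -> : \sum_(0 <= i < n) ((i.+1%:R * i.+2%:R)^-1 : R) = 1 - n.+1%:R^-1.
  by rewrite gerBl invr_ge0.
elim: n => [|n IH]; first by rewrite big_nil invr1 subrr.
rewrite big_nat_recr//= IH -!natr1; field.
have n0 : 0 <= n%:R :> R by [].
by apply/andP; split; apply: lt0r_neq0; lra.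
Qed.

(** Markov's inequality and Borel-Cantelli, the comparison series being telescopic. *)
Lemma ae_eventually_lt1_inv_sqr (F : nat -> T -> R) (C : R) :
  (forall n, measurable_fun setT (F n)) -> (forall n w, 0 <= F n w) ->
  (\forall n \near \oo, \int[P]_w (F n w)%:E <= (C / (n.+1%:R * n.+2%:R))%:E)%E ->
  {ae P, forall w, \forall n \near \oo, F n w < 1}.
Proof.
move=> mF F0 [n0 _ H].
(* Shifting by [n0] makes the bound on expectations valid at every index. *)
pose G n := [set w | 1 <= F (n + n0)%N w].
have mG n : measurable (G n).
  rewrite /G [X in measurable X](_ : _ = setT `&` F (n + n0)%N @^-1` `[1, +oo[%classic).
    exact: mF.
  by apply/seteqP; split => w /=; rewrite in_itv/= andbT; [split|case].
have PG n : (P (G n) <= (C / ((n + n0).+1%:R * (n + n0).+2%:R))%:E)%E.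
  apply: le_trans (H (n + n0)%N _); last by rewrite /= leq_addl.
  rewrite -[G n]setIT -integral_indic//.
  apply: ge0_le_integral => //.
  - exact/measurable_EFinP.
  - exact/measurable_EFinP.
  - move=> w _; rewrite lee_fin indicE; case: (boolP (w \in G n)) => //=.
    by rewrite inE /G.
have C0 : 0 <= C.
  have := le_trans (measure_ge0 P _) (PG 0%N).
  by rewrite lee_fin pmulr_lge0// invr_gt0 mulr_gt0.
have sumG : (\sum_(n <oo) P (G n) < +oo)%E.
  apply: (@le_lt_trans _ _ C%:E); last exact: ltry.
  apply: lime_le; first exact: is_cvg_nneseries.
  apply: nearW => n.
  apply: (@le_trans _ _ (\sum_(0 <= i < n) (C / (i.+1%:R * i.+2%:R))%:E)%E).
    apply: lee_sum => i _; apply: le_trans (PG i) _.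
    rewrite lee_fin ler_wpM2l// lef_pV2 ?posrE ?mulr_gt0//.
    by rewrite -!natrM ler_nat leq_mul// !ltnS leq_addr.
  rewrite sumEFin lee_fin -mulr_sumr -[leRHS]mulr1 ler_wpM2l//.
  exact: sum_telescope_le1.
have := lim_sup_set_cvg0 mG sumG => L0.
exists (lim_sup_set G); split => //.
  by apply: bigcap_measurable => // k _; apply: bigcup_measurable => j _; exact: mG.
move=> w /= Hw n _ /=; apply: contrapT => Hn; apply: Hw.
exists (n + n0)%N => // m /= nm; rewrite ltNge; apply/negP => Fm; apply: Hn.
exists (m - n0)%N => /=; first by rewrite leq_subRL ?(leq_trans (leq_addl n n0))// addnC.
by rewrite /G /= subnK// (leq_trans (leq_addl n n0)).
Qed.

Lemma expRN_sqrt_le (c : R) (n : nat) : 0 < c -> (0 < n)%N ->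
  n%:R * expR (- (c * Num.sqrt n%:R)) <= 6 * (6 / c) ^+ 6 / (n.+1%:R * n.+2%:R).
Proof.
move=> c0 n0; have nR : 0 < n%:R :> R by rewrite ltr0n.
have s0 : 0 < Num.sqrt n%:R :> R by rewrite sqrtr_gt0.
have x0 : 0 < c * Num.sqrt n%:R by exact: mulr_gt0.
have h := expR_sixth_power_le (ltW x0).
have -> : expR (- (c * Num.sqrt n%:R)) = (expR (c * Num.sqrt n%:R))^-1 by rewrite expRN.
apply: (@le_trans _ _ (n%:R * ((c * Num.sqrt n%:R / 6) ^+ 6)^-1)).
  by rewrite ler_wpM2l// lef_pV2// posrE ?expR_gt0// exprn_gt0// divr_gt0.
have -> : n%:R * ((c * Num.sqrt n%:R / 6) ^+ 6)^-1 = (6 / c) ^+ 6 / n%:R ^+ 2 :> R.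
  have s6 : Num.sqrt n%:R ^+ 6 = n%:R ^+ 3 :> R.
    by rewrite -[6%N]/(2 * 3)%N exprM sqr_sqrtr.
  rewrite !exprMn s6 exprVn; field.
  by apply/andP; split; exact: lt0r_neq0.
have K0 : 0 <= (6 / c) ^+ 6 by rewrite exprn_ge0// divr_ge0// ltW.
rewrite [leRHS](_ : _ = (6 / c) ^+ 6 * (6 / (n.+1%:R * n.+2%:R))); last by ring.
rewrite ler_wpM2l// ler_pdivlMr ?mulr_gt0//.
rewrite mulrC ler_pdivrMr ?exprn_gt0// -!natr1.
have : 1 <= n%:R :> R by rewrite ler1n.
by nra.
Qed.

(** The factor [n] pays for union bounds over [p n] coordinates; the rate [sqrt n] is that of the
    cross term. *)
Lemma ae_eventually_lt1 (F : nat -> T -> R) (K c : R) : 0 < c ->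
  (forall n, measurable_fun setT (F n)) -> (forall n w, 0 <= F n w) ->
  (\forall n \near \oo,
     \int[P]_w (F n w)%:E <= (K * (n%:R * expR (- (c * Num.sqrt n%:R))))%:E)%E ->
  {ae P, forall w, \forall n \near \oo, F n w < 1}.
Proof.
move=> c0 mF F0 H.
apply: (@ae_eventually_lt1_inv_sqr _ (`|K| * (6 * (6 / c) ^+ 6))) => //.
near=> n.
apply: le_trans (near H n _) _ => //.
rewrite lee_fin -mulrA.
apply: (@le_trans _ _ (`|K| * (n%:R * expR (- (c * Num.sqrt n%:R))))).
  by rewrite ler_wpM2r ?ler_norm// mulr_ge0// expR_ge0.
rewrite ler_wpM2l//; apply: expRN_sqrt_le => //.
by near: n; exact: nbhs_infty_gt.
Unshelve. all: by end_near. Qed.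

End borel_cantelli.

(** * Linear algebra *)

Lemma cauchy_schwarz_sum (R : realType) (p : nat) (a b : 'I_p -> R) :
  (\sum_j a j * b j) ^+ 2 <= (\sum_j a j ^+ 2) * (\sum_j b j ^+ 2).
Proof.
set x := \sum_j a j ^+ 2; set y := \sum_j b j ^+ 2; set w := \sum_j a j * b j.
have y0 : 0 <= y by apply: sumr_ge0 => j _; rewrite sqr_ge0.
have [y00|yn] := eqVneq y 0.
  have b0 j : b j = 0.
    move/eqP: y00; rewrite psumr_eq0; last by move=> i _; rewrite sqr_ge0.
    by move=> /allP/(_ j (mem_index_enum j)); rewrite sqrf_eq0 => /eqP.
  by rewrite /w big1 ?expr0n ?y00 ?mulr0// => j _; rewrite b0 mulr0.
have yp : 0 < y by rewrite lt0r yn.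
have : 0 <= \sum_j (y * a j - w * b j) ^+ 2 by apply: sumr_ge0 => j _; rewrite sqr_ge0.
have -> : \sum_j (y * a j - w * b j) ^+ 2 = y ^+ 2 * x - 2 * y * w * w + w ^+ 2 * y.
  transitivity (\sum_j y ^+ 2 * a j ^+ 2 - \sum_j 2 * y * w * (a j * b j) +
                \sum_j w ^+ 2 * b j ^+ 2); last by rewrite -!mulr_sumr.
  by rewrite -sumrB -big_split/=; apply: eq_bigr => j _; ring.
move=> h; have : 0 <= y * (x * y - w ^+ 2).
  by rewrite [leRHS](_ : _ = y ^+ 2 * x - 2 * y * w * w + w ^+ 2 * y)//; ring.
by rewrite pmulr_rge0// subr_ge0.
Qed.

Section dot_product.
Context {R : realType} {p : nat}.
Implicit Types (a b c : 'cV[R]_p) (t : R) (A : 'M[R]_p).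

Lemma dotvE a b : dotv a b = \sum_j a j 0 * b j 0.
Proof. by rewrite /dotv mxE; apply: eq_bigr => j _; rewrite mxE. Qed.

Lemma dotvC a b : dotv a b = dotv b a.
Proof. by rewrite !dotvE; apply: eq_bigr => j _; rewrite mulrC. Qed.

Lemma dotvDl a b c : dotv (a + b) c = dotv a c + dotv b c.
Proof. by rewrite !dotvE -big_split; apply: eq_bigr => j _; rewrite mxE mulrDl. Qed.

Lemma dotvZl t a b : dotv (t *: a) b = t * dotv a b.
Proof. by rewrite !dotvE mulr_sumr; apply: eq_bigr => j _; rewrite mxE mulrA. Qed.

Lemma dotvDr a b c : dotv a (b + c) = dotv a b + dotv a c.
Proof. by rewrite dotvC dotvDl !(dotvC a). Qed.

Lemma dotvZr t a b : dotv a (t *: b) = t * dotv a b.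
Proof. by rewrite dotvC dotvZl dotvC. Qed.

Lemma dotvNl a b : dotv (- a) b = - dotv a b.
Proof. by rewrite -scaleN1r dotvZl mulN1r. Qed.

Lemma dotvNr a b : dotv a (- b) = - dotv a b.
Proof. by rewrite dotvC dotvNl dotvC. Qed.

Lemma dotv0l a : dotv 0 a = 0.
Proof. by rewrite dotvE big1// => j _; rewrite mxE mul0r. Qed.

Lemma dotv_ge0 a : 0 <= dotv a a.
Proof. by rewrite dotvE; apply: sumr_ge0 => j _; rewrite -expr2 sqr_ge0. Qed.

Lemma dotv_eq0 a : (dotv a a == 0) = (a == 0).
Proof.
apply/eqP/eqP => [|->]; last exact: dotv0l.
rewrite dotvE => /eqP; rewrite psumr_eq0; last by move=> j _; rewrite -expr2 sqr_ge0.
move=> /allP h; apply/matrixP => i j; rewrite ord1 mxE.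
have /eqP := h i (mem_index_enum i); rewrite -expr2 => /eqP; rewrite sqrf_eq0.
by move/eqP.
Qed.

Lemma cauchy_schwarz_dotv a b : dotv a b ^+ 2 <= dotv a a * dotv b b.
Proof.
rewrite !dotvE.
under [X in _ <= X * _]eq_bigr do rewrite -expr2.
under [X in _ <= _ * X]eq_bigr do rewrite -expr2.
exact: cauchy_schwarz_sum.
Qed.

Lemma dotv_mulmx_sym A a b : A^T = A -> dotv a (A *m b) = dotv (A *m a) b.
Proof. by move=> sA; rewrite /dotv trmx_mul sA mulmxA. Qed.

(* A maximiser of the Rayleigh quotient on the compact unit sphere is an
   eigenvector, hence the top eigenvalue dominates the quadratic form. *)
Lemma rayleigh_le_top_eigenvalue A (lam : R) : A^T = A -> (0 < p)%N ->
  (forall (mu : R) a, a != 0 -> A *m a = mu *: a -> mu <= lam) ->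
  forall a, dotv a (A *m a) <= lam * dotv a a.
Proof.
move=> sA p0 top.
(* Row vectors, because [rV_compact] and [EVT_max_rV] are stated for them. *)
pose f (x : 'rV[R]_p) : R := dotv x^T (A *m x^T).
pose g (x : 'rV[R]_p) : R := dotv x^T x^T.
pose S : set 'rV[R]_p := [set x | g x = 1].
have cont_coord i : continuous (fun x : 'rV[R]_p => x 0 i) by exact: coord_continuous.
have cont_sum (F : 'I_p -> 'rV[R]_p -> R) : (forall i, continuous (F i)) ->
    continuous (fun x => \sum_i F i x).
  move=> cF; elim: (index_enum _) => [|i s IH].
    rewrite (_ : (fun x => _) = cst 0); first exact: cst_continuous.
    by apply/funext => x; rewrite big_nil.
  rewrite (_ : (fun x => _) = (fun x => F i x + \sum_(j <- s) F j x)).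
    by move=> x; apply: continuousD; [exact: cF|exact: IH].
  by apply/funext => x; rewrite big_cons.
have cg : continuous g.
  rewrite (_ : g = fun x => \sum_i x 0 i * x 0 i); last first.
    by apply/funext => x; rewrite /g dotvE; apply: eq_bigr => i _; rewrite !mxE.
  by apply: cont_sum => i x; apply: continuousM; exact: cont_coord.
have cf : continuous f.
  rewrite (_ : f = fun x => \sum_i x 0 i * \sum_j A i j * x 0 j); last first.
    apply/funext => x; rewrite /f dotvE; apply: eq_bigr => i _; rewrite !mxE.
    by congr (_ * _); apply: eq_bigr => j _; rewrite mxE.
  apply: (cont_sum _) => i x; apply: continuousM; first exact: cont_coord.
  apply: (cont_sum (fun j y => A i j * y 0 j)) => j y.
  by apply: continuousM; [exact: cst_continuous|exact: cont_coord].
have Scompact : compact S.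
  apply: (subclosed_compact _ (@rV_compact R p (fun=> `[(- 1), 1]%classic) _)).
  - have : closed (g @^-1` [set x | x = 1]); last by [].
    by apply: preimage_closed; [move=> x _; exact: cg|exact: closed_eq].
  - by move=> _; exact: segment_compact.
  - move=> x; rewrite /S /= /g dotvE => gx i /=; rewrite in_itv/=.
    have : x 0 i ^+ 2 <= 1.
      rewrite -gx (bigD1 i)//= !mxE -expr2 lerDl; apply: sumr_ge0 => j _.
      by rewrite -expr2 sqr_ge0.
    move=> h; rewrite -ler_norml -(@ler_pXn2r _ 2)// ?nnegrE//.
    by rewrite real_normK ?num_real// expr1n.
have S0 : S !=set0.
  exists (delta_mx 0 (Ordinal p0)); rewrite /S /= /g dotvE (bigD1 (Ordinal p0))//=.
  rewrite !mxE !eqxx mulr1 big1 ?addr0// => j /negbTE jn.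
  by rewrite !mxE eqxx jn mulr0.
have [x Sx xmax] := EVT_max_rV S0 Scompact (continuous_subspaceT cf).
move: Sx; rewrite inE /S /= => gx.
set c := x^T; set mu := f x.
have cc : dotv c c = 1 by exact: gx.
have homog a : dotv a (A *m a) <= mu * dotv a a.
  have [->|a0] := eqVneq a 0; first by rewrite !dotv0l mulr0.
  have aa : 0 < dotv a a by rewrite lt0r dotv_eq0 a0 dotv_ge0.
  set t := (Num.sqrt (dotv a a))^-1.
  have t2 : t * t = (dotv a a)^-1 by rewrite -expr2 exprVn sqr_sqrtr// ltW.
  have := xmax (t *: a)^T; rewrite inE /S /= /g /f trmxK -scalemxAr.
  rewrite !dotvZl !dotvZr !mulrA t2 mulVf ?gt_eqF// => /(_ erefl).
  by rewrite -/mu mulrC ler_pdivrMr.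
have eig : A *m c = mu *: c.
  have [e eE] : exists e, e = A *m c - mu *: c by eexists.
  suff : e == 0 by rewrite eE subr_eq0 => /eqP.
  rewrite -dotv_eq0; apply/negPn/negP => e0.
  have e1 : 0 < dotv e e by rewrite lt0r e0 dotv_ge0.
  set k := dotv e (A *m e) - mu * dotv e e.
  (* Moving from the maximiser [c] along the residual [e] gains [2 t |e|^2] to first order. At
     [t = |e|^2 / (|k| + 1)] the second order cannot offset this gain, a contradiction unless
     [e = 0]. *)
  have ineq t : 2 * t * dotv e e + t ^+ 2 * k <= 0.
    have := homog (c + t *: e).
    have ce : dotv e (A *m c) - mu * dotv e c = dotv e e.
      by rewrite [in RHS]eE dotvC dotvDl dotvNl dotvZl !(dotvC e) -eE.
    rewrite mulmxDr -scalemxAr !(dotvDl, dotvDr, dotvZl, dotvZr).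
    rewrite (dotv_mulmx_sym c e sA) (dotvC (A *m c)) (dotvC c e) cc.
    have -> : dotv c (A *m c) = mu by [].
    move: ce; rewrite /k; set X := dotv e (A *m c); set Y := dotv e c => ce.
    by rewrite -ce; nra.
  have := ineq (dotv e e / (`|k| + 1)).
  have k1 : 0 < `|k| + 1 by rewrite ltr_wpDl.
  set t := _ / _; have t0 : 0 < t by rewrite divr_gt0.
  have tk : t * (`|k| + 1) = dotv e e by rewrite /t divfK// gt_eqF.
  have := ler_norm (- k); rewrite normrN => kk; nra.
have mulam : mu <= lam.
  apply: (top mu c) eig; apply/eqP => c0; move: cc; rewrite c0 dotv0l.
  by move/esym/eqP; rewrite oner_eq0.
move=> a; apply: le_trans (homog a) _.
by rewrite ler_wpM2r// dotv_ge0.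
Qed.

(** The component [w] of [u] orthogonal to [r] has norm [y], the sine. In
    [lam y^2 = C (w, b) + (w, A w)], Cauchy-Schwarz and [|C| <= 1] bound the first term by [y be],
    the hypothesis on [al] bounds the second by [al y^2], and one factor [y] cancels. *)
Lemma perturbed_eigenvector_bound A (u r : 'cV[R]_p) (lam l al be : R) :
  A^T = A -> dotv u u = 1 -> dotv r r = 1 -> A *m u = lam *: u -> l <= lam ->
  (forall a, dotv a r = 0 -> dotv a (A *m a) <= al * dotv a a) ->
  al < l -> 0 <= be ->
  (let b := A *m r - dotv r (A *m r) *: r in dotv b b <= be ^+ 2) ->
  Num.sqrt (1 - dotv u r ^+ 2) <= be / (l - al).
Proof.
move=> sA uu rr Au llam hal all be0 /= hb.
set C := dotv u r; set b := A *m r - _ in hb.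
pose w := u - C *: r.
have wr : dotv w r = 0 by rewrite /w dotvDl dotvNl dotvZl rr mulr1 subrr.
have ww : dotv w w = 1 - C ^+ 2.
  rewrite /w !(dotvDl, dotvDr, dotvNl, dotvNr, dotvZl, dotvZr) uu rr (dotvC r u) -/C.
  ring.
have wu : dotv w u = 1 - C ^+ 2.
  by rewrite /w dotvDl dotvNl dotvZl uu (dotvC r u) -/C expr2.
have w20 : 0 <= 1 - C ^+ 2 by rewrite -ww dotv_ge0.
set y := Num.sqrt _; have y0 : 0 <= y by exact: sqrtr_ge0.
have y2 : y ^+ 2 = 1 - C ^+ 2 by rewrite sqr_sqrtr.
have wb : dotv w (A *m r) = dotv w b.
  by rewrite /b dotvDr dotvNr dotvZr wr mulr0 subr0.
have main : lam * y ^+ 2 = C * dotv w b + dotv w (A *m w).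
  have -> : lam * y ^+ 2 = dotv w (A *m u) by rewrite Au dotvZr wu y2.
  have {1}-> : u = C *: r + w by rewrite /w addrC subrK.
  by rewrite mulmxDr -scalemxAr dotvDr dotvZr wb.
have C1 : `|C| <= 1.
  rewrite -(@ler_pXn2r _ 2)// ?nnegrE// real_normK ?num_real// expr1n.
  by rewrite -subr_ge0.
have wbb : `|dotv w b| <= y * be.
  rewrite -(@ler_pXn2r _ 2)// ?nnegrE ?mulr_ge0// real_normK ?num_real//.
  apply: le_trans (cauchy_schwarz_dotv _ _) _.
  by rewrite exprMn ww y2 ler_wpM2l.
have Cwb : C * dotv w b <= y * be.
  apply: le_trans (ler_norm _) _; rewrite normrM.
  by rewrite -[leRHS]mul1r ler_pM.
have := hal w wr; rewrite ww -y2 => hw.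
have l0 : 0 < l - al by lra.
rewrite ler_pdivlMr//.
have [->|yn] := eqVneq y 0; first by rewrite mul0r.
have yp : 0 < y by rewrite lt0r yn.
have : lam * y ^+ 2 <= y * be + al * y ^+ 2 by rewrite main lerD.
move=> h; have : y * (y * (l - al)) <= y * be by nra.
by rewrite ler_pM2l.
Qed.

End dot_product.

Lemma sin_vangle (R : realType) (p : nat) (u rho : 'cV[R]_p) :
  vnorm u = 1 -> rho != 0 ->
  sin (vangle u rho) = Num.sqrt (1 - dotv u ((vnorm rho)^-1 *: rho) ^+ 2).
Proof.
move=> u1 rho0.
have rr : 0 < dotv rho rho by rewrite lt0r dotv_eq0 rho0 dotv_ge0.
have nr : 0 < vnorm rho by rewrite sqrtr_gt0.
rewrite /vangle u1 mul1r dotvZr.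
set x := dotv u rho.
have uu : dotv u u = 1.
  by rewrite -(sqr_sqrtr (dotv_ge0 u)) -/(vnorm u) u1 expr1n.
have x1 : `|x| / vnorm rho <= 1.
  rewrite ler_pdivrMr// mul1r -(@ler_pXn2r _ 2)// ?nnegrE ?sqrtr_ge0//.
  rewrite real_normK ?num_real// /vnorm sqr_sqrtr ?dotv_ge0//.
  by have := cauchy_schwarz_dotv u rho; rewrite uu mul1r.
have x0 : 0 <= `|x| / vnorm rho by rewrite divr_ge0// ltW.
rewrite sin_acos; last by rewrite x1 (le_trans _ x0)// lerN10.
by congr Num.sqrt; rewrite !exprMn real_normK ?num_real// mulrC.
Qed.

(** * The single component model *)

Section single_component_model.
Context {R : realType} {d : measure_display} {T : measurableType d}
  (P : probability T R) (v : nat -> T -> R) (z : nat -> nat -> T -> R).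
Hypothesis normal_v : forall i, std_normal_rv P (v i).
Hypothesis normal_z : forall i j, std_normal_rv P (z i j).

Definition model_coord (k : nat + (nat * nat)) : T -> R :=
  match k with inl i => v i | inr ij => z ij.1 ij.2 end.

Hypothesis indep_vz : mutually_independent P model_coord.

Lemma std_normal_rv_mgf (X : T -> R) t : std_normal_rv P X ->
  (\int[P]_w (expR (t * X w))%:E = (expR (t ^+ 2 / 2))%:E)%E.
Proof.
move=> [mX hX]; rewrite -integral_normal_prob_expR.
pose f (x : R) : \bar R := (expR (t * x))%:E.
have mf : measurable_fun setT f by apply/measurable_EFinP; exact: measurableT_comp.
(* [normal_prob] lives on [measurableTypeR R], so [X] and [f] are retyped to that structure. *)
have mX' : @measurable_fun _ _ T (measurableTypeR R) setT X by exact: mX.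
have mf' : @measurable_fun _ _ (measurableTypeR R) (\bar R) setT f by exact: mf.
pose XM : {mfun T >-> measurableTypeR R} := HB.pack X (isMeasurableFun.Build _ _ _ _ _ mX').
transitivity (\int[distribution P XM]_y f y)%E.
  by rewrite (ge0_integral_distribution XM mf')// => y; rewrite lee_fin expR_ge0.
apply: (@eq_measure_integral _ (measurableTypeR R) R setT (normal_prob 0 1) (distribution P XM) f) => A mA _.
exact: hX.
Qed.

Lemma measurable_model_coord k : measurable_fun setT (model_coord k).
Proof. by case: k => [i|[i j]] /=; [case: (normal_v i)|case: (normal_z i j)]. Qed.

Definition row_index (i : nat) : set (nat + (nat * nat)) :=
  [set k | match k with inl i' => i' = i | inr ij => ij.1 = i end].

Lemma row_index_disjoint i j : i != j -> row_index i `&` row_index j = set0.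
Proof.
move=> ij; rewrite -subset0 => -[k|[k l]] /= [-> e]; by rewrite e eqxx in ij.
Qed.

(** The quadratic quantities below are sums over [i] of squares or products of such forms, with
    coefficients common to all rows; rows are independent, so exponential moments multiply. *)
Definition row_form (p : nat) (al : R) (a : 'I_p -> R) (i : nat) (w : T) : R :=
  al * v i w + \sum_(j < p) a j * z i j w.

Lemma row_form_sub_measurable p al (a : 'I_p -> R) i :
  sub_measurable model_coord (row_index i) (row_form al a i).
Proof.
apply: measurable_funD.
  apply: measurable_funM => //.
  exact: (@sub_measurable_coord _ _ _ _ model_coord (row_index i) (inl i)).
apply: measurable_sum => j; apply: measurable_funM => //.
exact: (@sub_measurable_coord _ _ _ _ model_coord (row_index i) (inr (i, j : nat))).
Qed.

Lemma measurable_row_form p al (a : 'I_p -> R) i :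
  measurable_fun setT (row_form al a i).
Proof.
exact: (sub_measurableW measurable_model_coord (@row_form_sub_measurable p al a i)).
Qed.

Lemma row_form_gaussian p al (a : 'I_p -> R) i :
  gaussian_mgf P (row_form al a i) (al ^+ 2 + \sum_(j < p) a j ^+ 2).
Proof.
split; first exact: measurable_row_form.
move=> t.
pose f w := expR (t * al * v i w).
pose h (j : 'I_p) w := expR (t * a j * z i j w).
transitivity (\int[P]_w (f w * \prod_(j <- index_enum 'I_p) h j w)%:E)%E.
  apply: eq_integral => w _; congr EFin; rewrite /f /h -expR_sum -expRD.
  congr expR; rewrite /row_form mulrDr mulrA mulr_sumr; congr (_ + _).
  by apply: eq_bigr => j _; rewrite mulrA.
have mh (j : 'I_p) : sub_measurable model_coord [set inr (i, j : nat)] (h j).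
  apply: measurableT_comp => //; apply: measurable_funM => //.
  exact: (@sub_measurable_coord _ _ _ _ model_coord _ (inr (i, j : nat))).
rewrite (expectation_mul_indep measurable_model_coord indep_vz
  (K := [set inl i]) (L := [set k | if k is inr _ then True else False])); first last.
- by move=> w; apply: prodr_ge0 => j _; exact: expR_ge0.
- by move=> w; exact: expR_ge0.
- apply: measurable_prod => j _; apply: sub_measurableS (mh j).
  by move=> k /= ->.
- apply: measurableT_comp => //; apply: measurable_funM => //.
  exact: (@sub_measurable_coord _ _ _ _ model_coord _ (inl i)).
- by rewrite -subset0 => k /= [->].
rewrite (expectation_prod_indep measurable_model_coord indep_vz
  (K := fun j : 'I_p => [set inr (i, j : nat)])) ?index_enum_uniq//; first last.
- by move=> j w; exact: expR_ge0.
- move=> j l jl; rewrite -subset0 => k /= [-> [e]].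
  by move: jl; rewrite (ord_inj e) eqxx.
rewrite /f (std_normal_rv_mgf (t * al) (normal_v i)).
under eq_bigr do rewrite /h (std_normal_rv_mgf _ (normal_z _ _)).
rewrite prodEFin -EFinM -expR_sum -expRD; congr (expR _)%:E.
rewrite mulrDr mulrDl exprMn; congr (_ + _).
rewrite mulr_sumr mulr_suml; apply: eq_bigr => j _.
by rewrite exprMn.
Qed.

Lemma expectation_prod_rows n (f : nat -> T -> R) :
  (forall i, sub_measurable model_coord (row_index i) (f i)) ->
  (forall i w, 0 <= f i w) ->
  (\int[P]_w (\prod_(i < n) f i w)%:E = \prod_(i < n) \int[P]_w (f i w)%:E)%E.
Proof.
move=> mf f0.
apply: (expectation_prod_indep measurable_model_coord indep_vz
  (K := fun i : 'I_n => row_index i)) => //; first exact: index_enum_uniq.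
by move=> i j ij; apply: row_index_disjoint; apply: contra ij => /eqP/ord_inj ->.
Qed.

Lemma expectation_expR_sum_sqr n p al (a : 'I_p -> R) t :
  let V := al ^+ 2 + \sum_(j < p) a j ^+ 2 in
  0 <= t -> 2 * (t * V) < 1 ->
  (\int[P]_w (expR (t * \sum_(i < n) row_form al a i w ^+ 2))%:E =
   ((Num.sqrt (1 - 2 * (t * V)))^-1 ^+ n)%:E)%E.
Proof.
move=> V t0 tV.
transitivity (\int[P]_w (\prod_(i < n) expR (t * row_form al a i w ^+ 2))%:E)%E.
  by apply: eq_integral => w _; rewrite -expR_sum mulr_sumr.
rewrite (expectation_prod_rows n (f := fun i w => expR (t * row_form al a i w ^+ 2))).
- under eq_bigr do rewrite (integral_expR_sqr (row_form_gaussian al a _) t0 tV).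
  by rewrite prodEFin prodr_const card_ord.
- move=> i; apply: measurableT_comp => //; apply: measurable_funM => //.
  by apply: measurable_funX; exact: row_form_sub_measurable.
- by move=> i w; exact: expR_ge0.
Qed.

Lemma prode_le_expR n (F : nat -> \bar R) (x : R) :
  (forall i, 0 <= F i)%E -> (forall i, F i <= (expR x)%:E)%E ->
  (\prod_(i < n) F i <= (expR (n%:R * x))%:E)%E.
Proof.
move=> F0 Fx; rewrite expRM_natl.
apply: (@le_trans _ _ (\prod_(i < n) (expR x)%:E)%E).
  suff [] : (0 <= \prod_(i < n) F i /\ \prod_(i < n) F i <= \prod_(i < n) (expR x)%:E)%E by [].
  apply: (big_ind2 (fun a b => 0 <= a /\ a <= b)%E) => [|a b a' b' [a0 ab] [a'0 ab']|i _].
  - by rewrite lexx.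
  - by split; [exact: mule_ge0|exact: lee_pmul].
  - by [].
by rewrite prodEFin prodr_const card_ord.
Qed.

Lemma expectation_expRN_sum_sqr n p al (a : 'I_p -> R) t :
  let V := al ^+ 2 + \sum_(j < p) a j ^+ 2 in 0 < V -> 0 <= t ->
  (\int[P]_w (expR (- t * \sum_(i < n) row_form al a i w ^+ 2))%:E <=
   (expR (n%:R * (- (t * V) + 31 / 20 * (t * V) ^+ 2)))%:E)%E.
Proof.
move=> V V0 t0.
rewrite [leLHS](_ : _ = \int[P]_w (\prod_(i < n) expR (- t * row_form al a i w ^+ 2))%:E)%E.
  rewrite (expectation_prod_rows n (f := fun i w => expR (- t * row_form al a i w ^+ 2))).
  - apply: (prode_le_expR n (F := fun i =>
      (\int[P]_w (expR (- t * row_form al a i w ^+ 2))%:E)%E)) => i.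
      by apply: integral_ge0 => w _; rewrite lee_fin expR_ge0.
    apply: le_trans (integral_expRN_sqr (row_form_gaussian al a i) V0 t0) _.
    rewrite lee_fin; apply: le_trans (expR_ge1Dx _); by rewrite addrA.
  - move=> i; apply: measurableT_comp => //; apply: measurable_funM => //.
    by apply: measurable_funX; exact: row_form_sub_measurable.
  - by move=> i w; exact: expR_ge0.
by apply: eq_integral => w _; rewrite -expR_sum mulr_sumr.
Qed.

(** Scale the first form by [s = a0^(-1/2)] and the second by [1 / s], and let [U], [D] be their sum
    and difference. Orthogonality of [q] and [b] gives both the same variance [V <= 2 a0], so
    [integral_expR_mul] applies row by row. *)
Lemma expectation_expR_sum_mul n p (q b : 'I_p -> R) (be a0 theta : R) :
  0 < a0 -> \sum_(j < p) q j ^+ 2 <= a0 ^+ 2 -> \sum_(j < p) q j * b j = 0 ->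
  be ^+ 2 + \sum_(j < p) b j ^+ 2 = 1 -> 0 <= theta -> theta * a0 <= 1 / 40 ->
  (\int[P]_w (expR (theta * \sum_(i < n) (row_form 0 q i w * row_form be b i w)))%:E <=
   (expR (n%:R * (6 / 5 * (theta * a0) ^+ 2)))%:E)%E.
Proof.
move=> a0p qa qb b1 th0 tha.
pose s := (Num.sqrt a0)^-1.
have sa : s ^+ 2 = a0^-1 by rewrite exprVn sqr_sqrtr// ltW.
have s0 : 0 < s by rewrite invr_gt0 sqrtr_gt0.
have s1 : s^-1 ^+ 2 = a0 by rewrite exprVn sa invrK.
pose V := a0^-1 * \sum_(j < p) q j ^+ 2 + a0.
have V0 : 0 < V.
  by rewrite /V ltr_wpDl// mulr_ge0 ?invr_ge0 ?(ltW a0p)//; apply: sumr_ge0 => j _; rewrite sqr_ge0.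
have V2 : theta * V / 2 <= theta * a0.
  rewrite -mulrA ler_wpM2l// ler_pdivrMr// /V.
  have : a0^-1 * \sum_(j < p) q j ^+ 2 <= a0.
    by rewrite mulrC ler_pdivrMr// -expr2.
  by lra.
have gaus (e : R) i : e ^+ 2 = 1 ->
    gaussian_mgf P (row_form (e * (be / s)) (fun j => s * q j + e * (b j / s)) i) V.
  move=> e1; have := row_form_gaussian (e * (be / s)) (fun j => s * q j + e * (b j / s)) i.
  congr (gaussian_mgf P _ _).
  have -> : \sum_(j < p) (s * q j + e * (b j / s)) ^+ 2 =
     s ^+ 2 * (\sum_(j < p) q j ^+ 2) + 2 * e * (\sum_(j < p) q j * b j) +
     e ^+ 2 * (s^-1 ^+ 2 * \sum_(j < p) b j ^+ 2).
    rewrite !mulr_sumr -!big_split/=; apply: eq_bigr => j _; field.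
    exact: lt0r_neq0.
  rewrite qb mulr0 addr0 e1 mul1r sa s1 !exprMn e1 mul1r s1 /V.
  by rewrite addrCA; congr (_ + _); rewrite mulrC -mulrDr b1 mulr1.
rewrite [leLHS](_ : _ = \int[P]_w (\prod_(i < n)
    expR (theta * (row_form 0 q i w * row_form be b i w)))%:E)%E; last first.
  by apply: eq_integral => w _; rewrite -expR_sum mulr_sumr.
rewrite (expectation_prod_rows n
  (f := fun i w => expR (theta * (row_form 0 q i w * row_form be b i w)))).
- apply: (prode_le_expR n (F := fun i =>
    (\int[P]_w (expR (theta * (row_form 0 q i w * row_form be b i w)))%:E)%E)) => i.
    by apply: integral_ge0 => w _; rewrite lee_fin expR_ge0.
  have g1 := gaus 1 i (expr1n _ _).
  have g2 : gaussian_mgf P (row_form (-1 * (be / s)) (fun j => s * q j + -1 * (b j / s)) i) V.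
    by apply: gaus; rewrite sqrrN expr1n.
  have h40 : theta * V / 2 <= 1 / 40 by exact: le_trans tha.
  have E w : 4 * (row_form 0 q i w * row_form be b i w) =
      row_form (1 * (be / s)) (fun j => s * q j + 1 * (b j / s)) i w ^+ 2 -
      row_form (-1 * (be / s)) (fun j => s * q j + -1 * (b j / s)) i w ^+ 2.
    have lin e : row_form (e * (be / s)) (fun j => s * q j + e * (b j / s)) i w =
       s * row_form 0 q i w + e / s * row_form be b i w.
      rewrite /row_form mul0r add0r mulrDr !mulr_sumr [RHS]addrCA -big_split/=.
      congr (_ + _); first by field; exact: lt0r_neq0.
      by apply: eq_bigr => j _; field; exact: lt0r_neq0.
    rewrite !lin; field; exact: lt0r_neq0.
  apply: le_trans (integral_expR_mul V0 th0 h40 E g1 g2) _.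
  have c0 : 0 <= 6 / 5 :> R by lra.
  have tV0 : 0 <= theta * V / 2 by rewrite divr_ge0// mulr_ge0// ltW.
  rewrite lee_fin ler_expR ler_wpM2l// ler_pXn2r ?nnegrE//.
  by rewrite mulr_ge0// ltW.
- move=> i; apply: measurableT_comp => //; apply: measurable_funM => //.
  by apply: measurable_funM; exact: row_form_sub_measurable.
- by move=> i w; exact: expR_ge0.
Qed.

End single_component_model.

(** * The noise operator norm *)

Section rounding.
Context {R : realType} (p n : nat) (z : nat -> nat -> R).

(** The quadratic form of the centred noise covariance [Z Z^T / n - 1]. *)
Definition noise_form (a : 'I_p -> R) : R :=
  n%:R^-1 * \sum_(i < n) (\sum_(j < p) a j * z i j) ^+ 2 - \sum_(j < p) a j ^+ 2.

Definition update (a : 'I_p -> R) (j : 'I_p) (x : R) : 'I_p -> R :=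
  fun l => if l == j then x else a l.

Lemma sum_update (a : 'I_p -> R) j x (g : R -> 'I_p -> R) :
  \sum_l g (update a j x l) l = g x j + \sum_(l | l != j) g (a l) l.
Proof.
rewrite (bigD1 j)//= /update eqxx; congr (_ + _).
by apply: eq_bigr => l /negbTE ->.
Qed.

Lemma update_id (a : 'I_p -> R) j : update a j (a j) = a.
Proof. by apply/funext => l; rewrite /update; case: eqP => // ->. Qed.

(** Along one coordinate the form is a quadratic polynomial; a chord over a unit interval exceeds it
    by [t (1 - t)] times the leading coefficient. *)
Lemma noise_form_update (a : 'I_p -> R) j (x t : R) :
  (1 - t) * noise_form (update a j x) + t * noise_form (update a j (x + 1)) =
  noise_form (update a j (x + t)) +
  t * (1 - t) * (n%:R^-1 * \sum_(i < n) z i j ^+ 2 - 1).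
Proof.
rewrite /noise_form !(sum_update _ _ _ (fun y _ => y ^+ 2)).
under eq_bigr do rewrite (sum_update _ _ _ (fun y l => y * z _ l)).
under [X in _ + t * (n%:R^-1 * X - _)]eq_bigr do
  rewrite (sum_update _ _ _ (fun y l => y * z _ l)).
under [X in _ = (n%:R^-1 * X - _) + _]eq_bigr do
  rewrite (sum_update _ _ _ (fun y l => y * z _ l)).
set C := fun i => \sum_(l < p | l != j) a l * z i l.
set D := \sum_(l < p | l != j) a l ^+ 2.
have key : (1 - t) * \sum_(i < n) (x * z i j + C i) ^+ 2 +
    t * \sum_(i < n) ((x + 1) * z i j + C i) ^+ 2 =
    \sum_(i < n) ((x + t) * z i j + C i) ^+ 2 + t * (1 - t) * \sum_(i < n) z i j ^+ 2.
  rewrite !mulr_sumr -!big_split/=; apply: eq_bigr => i _; ring.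
move: key; set S1 := \sum_(i < n) _; set S2 := \sum_(i < n) _.
set S3 := \sum_(i < n) _; set S4 := \sum_(i < n) _ => key.
rewrite -/(C _) in S1 S2 S3 key *.
have -> : (1 - t) * (n%:R^-1 * S1 - (x ^+ 2 + D)) +
   t * (n%:R^-1 * S2 - ((x + 1) ^+ 2 + D)) =
   n%:R^-1 * ((1 - t) * S1 + t * S2) - (1 - t) * (x ^+ 2 + D) - t * ((x + 1) ^+ 2 + D).
  ring.
by rewrite key; ring.
Qed.

(* Moving one coordinate to a neighbouring integer can be done so that the
   form decreases by at most delta / 4: along a coordinate it is a quadratic
   polynomial whose leading coefficient is at least - delta. *)
Lemma noise_form_round_seq (delta : R) (s : seq 'I_p) : 0 <= delta ->
  (forall j : 'I_p, 1 - delta <= n%:R^-1 * \sum_(i < n) z i j ^+ 2) ->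
  forall a : 'I_p -> R, uniq s -> exists k : 'I_p -> R,
  [/\ forall j, j \in s -> exists2 m : int, k j = m%:~R & `|k j - a j| <= 1,
      forall j, j \notin s -> k j = a j &
      noise_form a - (size s)%:R * (delta / 4) <= noise_form k].
Proof.
move=> d0 hz a; elim: s => [_|j s IH /= /andP[js us]].
  by exists a; split => //; rewrite mul0r subr0.
have [k [ks kn kq]] := IH us.
pose lo : R := (Num.floor (a j))%:~R.
pose t := a j - lo.
have t0 : 0 <= t by rewrite subr_ge0 floor_le_tmp.
have t1 : t < 1.
  by rewrite ltrBlDl /lo; have := floorD1_gt (a j); rewrite intrD.
have kj : k j = lo + t by rewrite kn// /t; ring.
have E := noise_form_update k j lo t.
rewrite -kj update_id in E.
have tt : t * (1 - t) <= 1 / 4 by have := sqr_ge0 (t - 1 / 2); rewrite sqrrB; lra.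
have hj := hz j.
have [m hm mq] : exists2 m : int, `|m%:~R - a j| <= 1 &
    noise_form k - delta / 4 <= noise_form (update k j m%:~R).
  have low : noise_form k - delta / 4 <=
     (1 - t) * noise_form (update k j lo) + t * noise_form (update k j (lo + 1)).
    rewrite E; set W := _ - 1; have hW : - delta <= W by rewrite /W; lra.
    rewrite lerD2l; have : 0 <= t * (1 - t) by apply: mulr_ge0 => //; lra.
    by nra.
  (* The chord value is a weighted mean of the values at the two neighbouring integers, so one of
     them reaches it. *)
  have [h|h] := leP (noise_form k - delta / 4) (noise_form (update k j lo)).
    exists (Num.floor (a j)) => //; rewrite -/lo ler_norml; move: t0 t1; rewrite /t; lra.
  exists (Num.floor (a j) + 1); rewrite intrD -/lo.
    by rewrite ler_norml; move: t0 t1; rewrite /t; lra.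
  by nra.
exists (update k j m%:~R); split.
- move=> l; rewrite inE /update; case: eqP => [-> _|/eqP lj /= ls]; first by exists m.
  exact: ks.
- move=> l; rewrite inE negb_or /update => /andP[/negbTE -> ls]; exact: kn.
- apply: le_trans mq; rewrite -natr1; lra.
Qed.

Lemma noise_form_round (delta : R) : 0 <= delta ->
  (forall j : 'I_p, 1 - delta <= n%:R^-1 * \sum_(i < n) z i j ^+ 2) ->
  forall a : 'I_p -> R, exists k : 'I_p -> int,
  (forall j, `|(k j)%:~R - a j| <= 1) /\
  noise_form a - p%:R * (delta / 4) <= noise_form (fun j => (k j)%:~R).
Proof.
move=> d0 hz a.
have [k [ks _ kq]] := noise_form_round_seq d0 hz a (enum_uniq 'I_p).
have ks' j : {m : int | k j = m%:~R & `|k j - a j| <= 1}.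
  by apply: cid2; apply: ks; rewrite mem_enum.
exists (fun j => s2val (ks' j)); split.
  by move=> j; case: (ks' j) => m /= <-.
have -> : (fun j => (s2val (ks' j))%:~R) = k.
  by apply/funext => j; case: (ks' j) => m /= ->.
by move: kq; rewrite -cardE card_ord.
Qed.

End rounding.

(** * From integer vectors of bounded norm to all vectors *)

Section lattice_bound.
Context {R : realType}.

Lemma noise_formZ (p n : nat) (z : nat -> nat -> R) (t : R) (a : 'I_p -> R) :
  noise_form n z (fun j => t * a j) = t ^+ 2 * noise_form n z a.
Proof.
rewrite /noise_form mulrBr; congr (_ - _).
  rewrite mulrCA; congr (_ * _); rewrite mulr_sumr; apply: eq_bigr => i _.
  by rewrite -exprMn mulr_sumr; congr (_ ^+ 2); apply: eq_bigr => j _; rewrite mulrA.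
by rewrite mulr_sumr; apply: eq_bigr => j _; rewrite exprMn.
Qed.

(** By homogeneity [a] may be scaled to norm [8 sqrt p]. Rounding moves it by at most [sqrt p], so
    the integer vector has norm at most [9 sqrt p]; comparing the squared norms costs the factor
    [81 / 64]. The rounding loss [p delta / 4] is a small fraction of [64 p delta]. *)
Lemma noise_form_le_lattice (p n : nat) (z : nat -> nat -> R) (y delta : R) :
  0 <= y -> 0 <= delta ->
  (forall j : 'I_p, 1 - delta <= n%:R^-1 * \sum_(i < n) z i j ^+ 2) ->
  (forall k : 'I_p -> int, \sum_j ((k j)%:~R : R) ^+ 2 <= 81 * p%:R ->
     noise_form n z (fun j => (k j)%:~R) <= y * \sum_j (k j)%:~R ^+ 2) ->
  forall a : 'I_p -> R, noise_form n z a <= (81 / 64 * y + delta) * \sum_j a j ^+ 2.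
Proof.
move=> y0 d0 hz hk a; set N := \sum_j a j ^+ 2.
have N0 : 0 <= N by apply: sumr_ge0 => j _; rewrite sqr_ge0.
have [N00|Nn] := eqVneq N 0.
  have a0 j : a j = 0.
    move/eqP: N00; rewrite psumr_eq0; last by move=> i _; rewrite sqr_ge0.
    by move=> /allP/(_ j (mem_index_enum j)); rewrite sqrf_eq0 => /eqP.
  rewrite N00 mulr0 /noise_form -/N N00 subr0 big1 ?mulr0// => i _.
  by rewrite big1 ?expr0n// => j _; rewrite a0 mul0r.
have Np : 0 < N by rewrite lt0r Nn.
have p0 : 0 < p%:R :> R.
  rewrite ltr0n lt0n; apply/eqP => p0; move: Np.
  by rewrite /N; move: a {N N0 Nn} hz hk; rewrite p0 => a hz hk; rewrite big_ord0 ltxx.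
pose t := 8 * Num.sqrt p%:R / Num.sqrt N.
have t2 : t ^+ 2 = 64 * p%:R / N.
  by rewrite /t !exprMn exprVn !sqr_sqrtr//; congr (_ / _); ring.
have t2N : t ^+ 2 * N = 64 * p%:R by rewrite t2 divfK// gt_eqF.
have [k [kr kq]] := noise_form_round d0 hz (fun j => t * a j).
set A := fun j => t * a j in kr kq.
have AA : \sum_j A j ^+ 2 = 64 * p%:R.
  by rewrite -t2N mulr_sumr; apply: eq_bigr => j _; rewrite exprMn.
pose e j := (k j)%:~R - A j.
have ee : \sum_j e j ^+ 2 <= p%:R.
  rewrite -[X in _ <= X%:R](card_ord p) -sumr_const; apply: ler_sum => j _.
  rewrite -real_normK ?num_real// -(expr1n _ 2) ler_pXn2r ?nnegrE//; exact: kr.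
have Ae : \sum_j A j * e j <= 8 * p%:R.
  have := cauchy_schwarz_sum A e; rewrite AA => cs.
  have cs' : (\sum_j A j * e j) ^+ 2 <= (8 * p%:R) ^+ 2.
    apply: le_trans cs _; rewrite exprMn expr2.
    have -> : 8 * 8 * p%:R ^+ 2 = 64 * p%:R * p%:R :> R by ring.
    by rewrite ler_wpM2l// mulr_ge0// ltW.
  apply: le_trans (ler_norm _) _.
  have h8 : 0 <= 8 * p%:R :> R by rewrite mulr_ge0.
  by rewrite -(@ler_pXn2r _ 2)// ?nnegrE// real_normK ?num_real.
have kk : \sum_j ((k j)%:~R : R) ^+ 2 <= 81 * p%:R.
  have -> : \sum_j ((k j)%:~R : R) ^+ 2 =
     \sum_j A j ^+ 2 + 2 * (\sum_j A j * e j) + \sum_j e j ^+ 2.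
    rewrite mulr_sumr -!big_split/=; apply: eq_bigr => j _.
    by rewrite /e; ring.
  by rewrite AA; lra.
have := hk k kk => hk1.
have : t ^+ 2 * noise_form n z a - p%:R * (delta / 4) <= y * (81 * p%:R).
  rewrite -noise_formZ; apply: le_trans kq _; apply: le_trans hk1 _.
  by rewrite ler_wpM2l.
have -> : t ^+ 2 * noise_form n z a = p%:R * (64 * (noise_form n z a / N)).
  by rewrite t2; field; exact: lt0r_neq0.
set f := noise_form n z a / N => h.
have : p%:R * (64 * f) <= p%:R * (81 * y + delta / 4) by lra.
rewrite ler_pM2l// => {}h.
have : f <= 81 / 64 * y + delta by lra.
by rewrite /f ler_pdivrMr.
Qed.

End lattice_bound.

(** * Lower tails of chi-square sums *)

Section almost_sure_bounds.
Context {R : realType} {d : measure_display} {T : measurableType d}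
  (P : probability T R) (v : nat -> T -> R) (z : nat -> nat -> T -> R).
Hypothesis normal_v : forall i, std_normal_rv P (v i).
Hypothesis normal_z : forall i j, std_normal_rv P (z i j).
Hypothesis indep_vz : mutually_independent P (model_coord v z).
Variables (p : nat -> nat) (c : R).
Hypothesis p_cvg : (fun n : nat => (p n)%:R / n%:R : R) @ \oo --> c.

Let mrow (q : nat) al (a : 'I_q -> R) i : measurable_fun setT (row_form v z al a i) :=
  measurable_row_form normal_v normal_z al a i.

(** A bound is asked only where the weight is nonzero; the zero lattice vector, which has no
    direction, gets weight 0. *)
Lemma le_integral_wsum (J : Type) (s : seq J) (cc : J -> R)
    (G : J -> T -> R) (u : J -> R) :
  (forall j, measurable_fun setT (G j)) -> (forall j w, 0 <= G j w) ->
  (forall j, 0 <= cc j) ->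
  (forall j, cc j != 0 -> (\int[P]_w (G j w)%:E <= (u j)%:E)%E) ->
  (\int[P]_w (\sum_(j <- s) cc j * G j w)%:E <= (\sum_(j <- s) cc j * u j)%:E)%E.
Proof.
move=> mG G0 cc0 Gu.
under eq_integral do rewrite -sumEFin.
rewrite ge0_integral_sum//; last 2 first.
- by move=> j; apply/measurable_EFinP; exact: measurable_funM.
- by move=> j w _; rewrite lee_fin mulr_ge0.
rewrite -sumEFin; apply: lee_sum => j _.
under eq_integral do rewrite EFinM.
rewrite ge0_integralZl//.
- have [->|cj] := eqVneq (cc j) 0; first by rewrite mul0e mul0r.
  by rewrite EFinM lee_wpmul2l ?lee_fin//; exact: Gu.
- exact/measurable_EFinP.
- by move=> w _; rewrite lee_fin.
- by rewrite lee_fin.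
Qed.

Lemma measurable_expR_sum_sqr (q n : nat) t al (a : 'I_q -> R) :
  measurable_fun setT (fun w => expR (t * \sum_(i < n) row_form v z al a i w ^+ 2)).
Proof.
apply: measurableT_comp => //; apply: measurable_funM => //.
by apply: measurable_sum => i; apply: measurable_funX; exact: mrow.
Qed.

Lemma p_near_le : \forall n \near \oo, (p n)%:R <= (c + 1) * n%:R.
Proof.
have h : \forall n \near \oo, (p n)%:R / n%:R < c + 1 :> R.
  by apply: cvgr_lt p_cvg _ _; rewrite ltrDl.
near=> n; have n0 : 0 < n%:R :> R by rewrite ltr0n; near: n; exact: nbhs_infty_gt.
by rewrite -ler_pdivrMr//; apply: ltW; near: n.
Unshelve. all: by end_near. Qed.

Lemma sqrt_natr_le (n : nat) : Num.sqrt n%:R <= n%:R :> R.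
Proof.
case: n => [|n]; first by rewrite sqrtr0.
rewrite -[leRHS]ger0_norm// -sqrtr_sqr ler_sqrt ?sqr_ge0//.
by rewrite expr2 ler_peMr// ler1n.
Qed.

Lemma expR_chernoff_le (delta : R) (n : nat) : (0 < n)%N -> 0 <= delta ->
  expR (- (n%:R * delta)) <= n%:R * expR (- (delta * Num.sqrt n%:R)).
Proof.
move=> n0 d0; rewrite -[leLHS]mul1r ler_pM ?expR_ge0 ?ler1n//.
by rewrite ler_expR lerN2 mulrC ler_wpM2r// sqrt_natr_le.
Qed.

(** With parameter [delta / 4] the exponent per row is [(- 1/4 + 31/320) delta^2], below
    [- delta^2 / 8]. *)
Lemma expectation_lower_chernoff (q n : nat) al (a : 'I_q -> R) (delta : R) :
  al ^+ 2 + \sum_j a j ^+ 2 = 1 -> 0 <= delta ->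
  (\int[P]_w (expR (delta / 4 * (n%:R * (1 - delta))) *
     expR (- (delta / 4) * \sum_(i < n) row_form v z al a i w ^+ 2))%:E
   <= (expR (- (n%:R * (delta ^+ 2 / 8))))%:E)%E.
Proof.
move=> V1 d0.
have V0 : 0 < al ^+ 2 + \sum_j a j ^+ 2 by rewrite V1.
have d40 : 0 <= delta / 4 by rewrite divr_ge0.
have := expectation_expRN_sum_sqr normal_v normal_z indep_vz n V0 d40.
rewrite V1 mulr1 => h.
under eq_integral do rewrite EFinM.
rewrite ge0_integralZl//;
  last by apply/measurable_EFinP; exact: measurable_expR_sum_sqr.
apply: (@le_trans _ _ ((expR (delta / 4 * (n%:R * (1 - delta))))%:E *
  (expR (n%:R * (- (delta / 4) + 31 / 20 * (delta / 4) ^+ 2)))%:E)%E).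
  by rewrite lee_wpmul2l ?lee_fin ?expR_ge0.
rewrite -EFinM lee_fin -expRD ler_expR.
have n0 : 0 <= n%:R :> R by [].
have nd : 0 <= n%:R * delta ^+ 2 by rewrite mulr_ge0// sqr_ge0.
by nra.
Qed.

Lemma ae_sum_sqr_ge (be : nat -> R) (b : forall n, 'I_(p n) -> R) (delta : R) :
  0 < delta -> (\forall n \near \oo, be n ^+ 2 + \sum_j b n j ^+ 2 = 1) ->
  {ae P, forall w, \forall n \near \oo,
     (1 - delta) * n%:R <= \sum_(i < n) row_form v z (be n) (b n) i w ^+ 2}.
Proof.
move=> d0 V1.
pose F n w := expR (delta / 4 * (n%:R * (1 - delta))) *
   expR (- (delta / 4) * \sum_(i < n) row_form v z (be n) (b n) i w ^+ 2).
have : {ae P, forall w, \forall n \near \oo, F n w < 1}.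
  apply: (@ae_eventually_lt1 _ _ _ _ _ 1 (delta ^+ 2 / 8)).
  - by rewrite divr_gt0// exprn_gt0.
  - by move=> n; apply: measurable_funM => //; exact: measurable_expR_sum_sqr.
  - by move=> n w; rewrite mulr_ge0 ?expR_ge0.
  - near=> n; rewrite mul1r.
    apply: (@le_trans _ _ (expR (- (n%:R * (delta ^+ 2 / 8))))%:E); last first.
      rewrite lee_fin expR_chernoff_le//; last by rewrite divr_ge0// sqr_ge0.
      by near: n; exact: nbhs_infty_gt.
    by apply: expectation_lower_chernoff; [near: n|exact: ltW].
apply: filterS => w; apply: filterS => n.
rewrite /F -expRD expR_lt1 => h.
have : delta / 4 * ((1 - delta) * n%:R) <=
  delta / 4 * (\sum_(i < n) row_form v z (be n) (b n) i w ^+ 2) by lra.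
by rewrite ler_pM2l// divr_gt0.
Unshelve. all: by end_near. Qed.

End almost_sure_bounds.

(** * Weighted union bound over the lattice *)

Section noise_operator_bound.
Context {R : realType} {d : measure_display} {T : measurableType d}
  (P : probability T R) (v : nat -> T -> R) (z : nat -> nat -> T -> R).
Hypothesis normal_v : forall i, std_normal_rv P (v i).
Hypothesis normal_z : forall i j, std_normal_rv P (z i j).
Hypothesis indep_vz : mutually_independent P (model_coord v z).
Variables (p : nat -> nat) (c : R).
Hypothesis p_cvg : (fun n : nat => (p n)%:R / n%:R : R) @ \oo --> c.

Lemma row_form_unit (q : nat) (j : 'I_q) i w :
  row_form v z 0 (fun l : 'I_q => (l == j)%:R) i w = z i j w.
Proof.
rewrite /row_form mul0r add0r (bigD1 j)//= eqxx mul1r big1 ?addr0//.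
by move=> l /negbTE ->; rewrite mul0r.
Qed.

Lemma sum_sqr_unit (q : nat) (j : 'I_q) :
  0 ^+ 2 + \sum_(l < q) ((l == j)%:R : R) ^+ 2 = 1.
Proof.
rewrite expr0n add0r (bigD1 j)//= eqxx expr1n big1 ?addr0//.
by move=> l /negbTE ->; rewrite expr0n.
Qed.

Lemma ae_column_sqr_ge (delta : R) : 0 < delta ->
  {ae P, forall w, \forall n \near \oo, forall j : 'I_(p n),
     1 - delta <= n%:R^-1 * \sum_(i < n) z i j w ^+ 2}.
Proof.
move=> d0.
pose G n (j : 'I_(p n)) w := expR (delta / 4 * (n%:R * (1 - delta))) *
   expR (- (delta / 4) * \sum_(i < n) row_form v z 0 (fun l => (l == j)%:R) i w ^+ 2).
have mG n j : measurable_fun setT (G n j).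
  by apply: measurable_funM => //; exact: (measurable_expR_sum_sqr normal_v normal_z).
have G0 n j w : 0 <= G n j w by rewrite mulr_ge0 ?expR_ge0.
pose F n w := \sum_j 1 * G n j w.
have : {ae P, forall w, \forall n \near \oo, F n w < 1}.
  apply: (@ae_eventually_lt1 _ _ _ _ _ (c + 1) (delta ^+ 2 / 8)).
  - by rewrite divr_gt0// exprn_gt0.
  - by move=> n; apply: measurable_sum => j; exact: measurable_funM.
  - by move=> n w; apply: sumr_ge0 => j _; rewrite mul1r.
  - near=> n.
    apply: (@le_trans _ _ (\sum_(j < p n) 1 * expR (- (n%:R * (delta ^+ 2 / 8))))%:E).
      apply: le_integral_wsum => //.
      move=> j _; apply: (expectation_lower_chernoff normal_v normal_z indep_vz).
        exact: sum_sqr_unit.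
      exact: ltW.
    rewrite lee_fin mul1r sumr_const card_ord -[leLHS]mulr_natl [leRHS]mulrA.
    rewrite ler_pM ?expR_ge0//; first by near: n; exact: p_near_le.
    by rewrite ler_expR lerN2 mulrC ler_wpM2r ?sqrt_natr_le// divr_ge0 ?sqr_ge0.
apply: filterS => w Fw; near=> n => j.
have n0 : 0 < n%:R :> R by rewrite ltr0n; near: n; exact: nbhs_infty_gt.
have F1 : F n w < 1 by near: n.
have : G n j w < 1.
  apply: le_lt_trans F1; rewrite /F (bigD1 j)//= mul1r lerDl.
  by apply: sumr_ge0 => l _; rewrite mul1r.
rewrite /G -expRD expR_lt1 => h.
have {}h : delta / 4 * (n%:R * (1 - delta)) <=
  delta / 4 * (\sum_(i < n) row_form v z 0 (fun l => (l == j)%:R) i w ^+ 2) by lra.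
move: h; rewrite ler_pM2l ?divr_gt0// => h.
rewrite mulrC ler_pdivlMr// mulrC; apply: le_trans h _.
by apply: ler_sum => i _; rewrite row_form_unit.
Unshelve. all: by end_near. Qed.

(* Codes for the integers of absolute value less than M; zero is coded twice. *)
Definition code_val (M : nat) (k : bool * 'I_M) : R := (-1) ^+ k.1 * (k.2 : nat)%:R.

Lemma geometric_expR_le (M : nat) : \sum_(m < M) expR (- (m%:R / 9)) <= 10 :> R.
Proof.
set q : R := expR (- (1 / 9)).
have e9 := expR_ge1Dx (1 / 9 : R).
have q0 : 0 < q by exact: expR_gt0.
have q1 : q <= 9 / 10.
  have := expRxMexpNx_1 (1 / 9 : R); rewrite -/q => e; nra.
have -> : \sum_(m < M) expR (- (m%:R / 9)) = \sum_(m < M) q ^+ m.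
  apply: eq_bigr => m _; rewrite /q -expRM_natl; congr expR; by field.
have h : (1 - q) * \sum_(m < M) q ^+ m = 1 - q ^+ M.
  elim: M => [|M IH]; first by rewrite big_ord0 mulr0 expr0 subrr.
  by rewrite big_ord_recr/= mulrDr IH exprS; ring.
have qM : 0 <= q ^+ M by rewrite exprn_ge0// ltW.
have S0 : 0 <= \sum_(m < M) q ^+ m by apply: sumr_ge0 => m _; rewrite exprn_ge0// ltW.
by nra.
Qed.

(** The sum factorises over coordinates. Each factor is at most [2 * 10 <= exp 4], two for the sign
    and ten for the geometric series, whatever the range [M]. *)
Lemma sum_code_weights (q M : nat) :
  \sum_(k : {ffun 'I_q -> bool * 'I_M})
     expR (- (\sum_j (((k j).2 : nat)%:R / 9))) <= expR (4 * q%:R) :> R.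
Proof.
have -> : \sum_(k : {ffun 'I_q -> bool * 'I_M}) expR (- (\sum_j (((k j).2 : nat)%:R / 9))) =
   \prod_(j < q) \sum_(a : bool * 'I_M) expR (- ((a.2 : nat)%:R / 9)) :> R.
  rewrite bigA_distr_bigA; apply: eq_bigr => k _.
  by rewrite -sumrN expR_sum.
rewrite prodr_const card_ord mulrC expRM_natl; apply: lerXn2r.
- by rewrite nnegrE; apply: sumr_ge0 => a _; exact: expR_ge0.
- by rewrite nnegrE expR_ge0.
apply: (@le_trans _ _ 20); last first.
  have -> : (4 : R) = 2%:R * 2 by ring.
  rewrite expRM_natl.
  have h : 5 <= expR 2 :> R by have := @expR_ge_quadratic R 2 (ler0n _ 2); lra.
  by rewrite expr2; nra.
rewrite -(pair_bigA _ (fun (b : bool) (m : 'I_M) => expR (- ((m : nat)%:R / 9))))/=.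
by rewrite big_bool/=; have := geometric_expR_le M; lra.
Qed.

(** With [Y = 1 + 2 u] the exponent is [- u^2 - (Y - 1 / Y) / 4] and the root is [sqrt Y]; what
    remains is the square root of [le_expR_half_subV]. *)
Lemma chi2_upper_factor (u : R) : 0 <= u ->
  expR (- (u / (1 + 2 * u) * (1 + 2 * u + 2 * u ^+ 2))) *
  (Num.sqrt (1 - 2 * (u / (1 + 2 * u))))^-1 <= expR (- u ^+ 2).
Proof.
move=> u0; set Y := 1 + 2 * u; have Y0 : 0 < Y by rewrite /Y; lra.
have Y1 : 1 <= Y by rewrite /Y; lra.
have -> : 1 - 2 * (u / Y) = Y^-1 by rewrite /Y; field; exact: lt0r_neq0.
have -> : (Num.sqrt Y^-1)^-1 = Num.sqrt Y by rewrite sqrtrV ?ltW// invrK.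
have -> : - (u / Y * (Y + 2 * u ^+ 2)) = - u ^+ 2 - (Y - Y^-1) / 4.
  by rewrite /Y; field; exact: lt0r_neq0.
rewrite expRD -[leRHS]mulr1 -mulrA ler_wpM2l ?expR_ge0// expRN mulrC.
rewrite ler_pdivrMr ?expR_gt0// mul1r.
rewrite -[leRHS]gtr0_norm ?expR_gt0// -sqrtr_sqr ler_sqrt ?sqr_ge0//.
rewrite -expRM_natl; apply: le_trans (le_expR_half_subV Y1) _.
by rewrite le_eqVlt; apply/orP; left; apply/eqP; congr expR; field; exact: lt0r_neq0.
Qed.

Section lattice_chernoff.
Variables (q n : nat) (u : R).
Hypothesis u0 : 0 <= u.
(** An integer vector of squared norm at most [81 q] has entries of absolute value at most [9 q],
    hence below [M]. *)
Let M := (9 * q).+1.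
Let t := u / (1 + 2 * u).
Let y := 1 + 2 * u + 2 * u ^+ 2.
Let nrm2 (k : {ffun 'I_q -> bool * 'I_M}) : R := \sum_j code_val (k j) ^+ 2.
Let dir (k : {ffun 'I_q -> bool * 'I_M}) (j : 'I_q) : R :=
  code_val (k j) / Num.sqrt (nrm2 k).
(** Cauchy-Schwarz bounds the sum of absolute values by [9 q] when the squared norm is at most
    [81 q]; division by 9 and the factor [exp q] then give weight at least 1. *)
Let wt (k : {ffun 'I_q -> bool * 'I_M}) : R :=
  (nrm2 k != 0)%:R * (expR q%:R * expR (- (\sum_j (((k j).2 : nat)%:R / 9)))).

(* The weights make the sum over all codes finite uniformly in their range, and
   are at least 1 on integer vectors of squared norm at most [81 q]. The values
   of [t] and [y] are those of the Laurent-Massart bound for chi-square tails. *)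
Definition lattice_chernoff (w : T) : R :=
  \sum_k wt k * (expR (- (n%:R * (t * y))) *
    expR (t * \sum_(i < n) row_form v z 0 (dir k) i w ^+ 2)).

Let wt0 k : 0 <= wt k.
Proof. by rewrite /wt !mulr_ge0// expR_ge0. Qed.

Lemma measurable_lattice_chernoff : measurable_fun setT lattice_chernoff.
Proof.
apply: measurable_sum => k; apply: measurable_funM => //; apply: measurable_funM => //.
exact: (measurable_expR_sum_sqr normal_v normal_z).
Qed.

Lemma lattice_chernoff_ge0 w : 0 <= lattice_chernoff w.
Proof. by apply: sumr_ge0 => k _; rewrite mulr_ge0// mulr_ge0// expR_ge0. Qed.

(** The [5] is [1 + 4]: the normalisation [exp q] of the weights and the bound [exp (4 q)] on their
    sum. It becomes the [5] under the root in [u]. *)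
Lemma expectation_lattice_chernoff :
  (\int[P]_w (lattice_chernoff w)%:E <= (expR (5 * q%:R - n%:R * u ^+ 2))%:E)%E.
Proof.
have u1 : 0 < 1 + 2 * u by move: u0 => h; lra.
have t0 : 0 <= t by rewrite /t divr_ge0// ltW.
have t1 : 2 * t < 1 by rewrite /t mulrA ltr_pdivrMr//; lra.
apply: (@le_trans _ _ (\sum_k wt k * expR (- (n%:R * u ^+ 2)))%:E).
  apply: le_integral_wsum.
  - move=> k; apply: measurable_funM => //.
    exact: (measurable_expR_sum_sqr normal_v normal_z).
  - by move=> k w; rewrite mulr_ge0 ?expR_ge0.
  - exact: wt0.
  - move=> k wk; have nk : nrm2 k != 0.
      by apply: contra wk => /eqP h; rewrite /wt h eqxx mul0r.
    have nk0 : 0 < nrm2 k.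
      by rewrite lt0r nk; apply: sumr_ge0 => j _; rewrite sqr_ge0.
    have V1 : 0 ^+ 2 + \sum_j dir k j ^+ 2 = 1.
      rewrite expr0n add0r -[RHS](divff nk) /nrm2 mulr_suml.
      apply: eq_bigr => j _; rewrite /dir exprMn exprVn sqr_sqrtr//.
      exact: ltW.
    have tV : 2 * (t * (0 ^+ 2 + \sum_j dir k j ^+ 2)) < 1 by rewrite V1 mulr1.
    under eq_integral do rewrite EFinM.
    rewrite ge0_integralZl//; last first.
      apply/measurable_EFinP; exact: (measurable_expR_sum_sqr normal_v normal_z).
    rewrite (expectation_expR_sum_sqr normal_v normal_z indep_vz n t0 tV) V1 mulr1.
    rewrite -EFinM lee_fin.
    have -> : - (n%:R * (t * y)) = n%:R * - (t * y) by ring.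
    have -> : - (n%:R * u ^+ 2) = n%:R * - u ^+ 2 by ring.
    rewrite !expRM_natl -exprMn; apply: lerXn2r.
    + by rewrite nnegrE mulr_ge0 ?expR_ge0// invr_ge0.
    + by rewrite nnegrE expR_ge0.
    + exact: chi2_upper_factor.
rewrite lee_fin -mulr_suml expRD ler_wpM2r ?expR_ge0//.
apply: (@le_trans _ _ (\sum_(k : {ffun 'I_q -> bool * 'I_M})
    expR q%:R * expR (- (\sum_j (((k j).2 : nat)%:R / 9))))).
  by apply: ler_sum => k _; rewrite ler_piMl ?mulr_ge0 ?expR_ge0//; case: (_ != _).
rewrite -mulr_sumr.
have -> : 5 * q%:R = q%:R + 4 * q%:R :> R by ring.
by rewrite expRD ler_wpM2l ?expR_ge0// sum_code_weights.
Qed.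

Lemma lattice_chernoff_lt1 w : (0 < n)%N -> 0 < u -> lattice_chernoff w < 1 ->
  forall k : 'I_q -> int, \sum_j ((k j)%:~R : R) ^+ 2 <= 81 * q%:R ->
  noise_form n (fun i j => z i j w) (fun j => (k j)%:~R) <=
  (2 * u + 2 * u ^+ 2) * \sum_j (k j)%:~R ^+ 2.
Proof.
move=> n0 up F1 k kk; have nR : 0 < n%:R :> R by rewrite ltr0n.
set N := \sum_j _ ^+ 2 in kk *.
have absk j : (`|k j| < M)%N.
  rewrite ltnS; have : ((k j)%:~R : R) ^+ 2 <= (9 * q%:R) ^+ 2.
    apply: (@le_trans _ _ N).
      by rewrite /N (bigD1 j)//= lerDl; apply: sumr_ge0 => l _; rewrite sqr_ge0.
    apply: le_trans kk _; rewrite exprMn.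
    have : 1 <= q%:R :> R by rewrite ler1n; exact: leq_trans (ltn_ord j).
    by nra.
  rewrite -real_normK ?num_real// ler_pXn2r ?nnegrE ?mulr_ge0//.
  by rewrite -intr_norm -abszE -natrM ler_nat.
pose kc : {ffun 'I_q -> bool * 'I_M} := [ffun j => ((k j < 0)%R, Ordinal (absk j))].
have kv j : code_val (kc j) = (k j)%:~R.
  rewrite /code_val ffunE/= [in RHS](intEsign (k j)) rmorphM/= rmorphXn/=.
  by rewrite rmorphN1.
have nN : nrm2 kc = N by apply: eq_bigr => j _; rewrite kv.
have N0 : 0 <= N by apply: sumr_ge0 => j _; rewrite sqr_ge0.
have [N00|Nn] := eqVneq N 0.
  have k0 j : (k j)%:~R = 0 :> R.
    move/eqP: N00; rewrite psumr_eq0; last by move=> i _; rewrite sqr_ge0.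
    by move=> /allP/(_ j (mem_index_enum j)); rewrite sqrf_eq0 => /eqP.
  rewrite N00 mulr0 /noise_form -/N N00 subr0 big1 ?mulr0// => i _.
  by rewrite big1 ?expr0n// => j _; rewrite k0 mul0r.
have Np : 0 < N by rewrite lt0r Nn.
have l1 : \sum_j ((`|k j| : nat)%:R : R) <= 9 * q%:R.
  have h9 : 0 <= 9 * q%:R :> R by rewrite mulr_ge0.
  have S0 : 0 <= \sum_j ((`|k j| : nat)%:R : R) by apply: sumr_ge0.
  rewrite -(@ler_pXn2r _ 2)// ?nnegrE//.
  have := cauchy_schwarz_sum (fun j => (`|k j| : nat)%:R : R) (fun=> 1).
  under eq_bigr do rewrite mulr1.
  move=> cs; apply: le_trans cs _.
  have -> : \sum_(j < q) (1 : R) ^+ 2 = q%:R.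
    by under eq_bigr do rewrite expr1n; rewrite sumr_const card_ord.
  have -> : \sum_j ((`|k j| : nat)%:R : R) ^+ 2 = N.
    by apply: eq_bigr => j _; rewrite pmulrn abszE intr_norm real_normK ?num_real.
  by rewrite exprMn; have : 0 <= q%:R :> R by []; nra.
have wt1 : 1 <= wt kc.
  rewrite /wt nN Nn mul1r -expRD -[leLHS]expR0 ler_expR subr_ge0.
  rewrite -mulr_suml ler_pdivrMr// mulrC; apply: le_trans l1.
  by rewrite le_eqVlt; apply/orP; left; apply/eqP; apply: eq_bigr => j _; rewrite ffunE.
have : expR (- (n%:R * (t * y))) *
    expR (t * \sum_(i < n) row_form v z 0 (dir kc) i w ^+ 2) < 1.
  apply: le_lt_trans F1; rewrite /lattice_chernoff (bigD1 kc)//=.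
  apply: (@le_trans _ _ (wt kc * (expR (- (n%:R * (t * y))) *
    expR (t * \sum_(i < n) row_form v z 0 (dir kc) i w ^+ 2)))).
    by rewrite ler_peMl// mulr_ge0 ?expR_ge0.
  by rewrite lerDl; apply: sumr_ge0 => l _; rewrite mulr_ge0// mulr_ge0// expR_ge0.
rewrite -expRD expR_lt1 => h.
have u1 : 0 < 1 + 2 * u by lra.
have tp : 0 < t by rewrite /t divr_gt0.
have {}h : \sum_(i < n) row_form v z 0 (dir kc) i w ^+ 2 <= n%:R * y.
  by rewrite -(ler_pM2l tp); lra.
have E : \sum_(i < n) row_form v z 0 (dir kc) i w ^+ 2 =
   (\sum_(i < n) (\sum_j (k j)%:~R * z i j w) ^+ 2) / N.
  rewrite mulr_suml; apply: eq_bigr => i _; rewrite /row_form mul0r add0r.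
  have -> : \sum_j dir kc j * z i j w = (\sum_j (k j)%:~R * z i j w) / Num.sqrt N.
    by rewrite mulr_suml; apply: eq_bigr => j _; rewrite /dir kv nN mulrAC.
  by rewrite exprMn exprVn sqr_sqrtr.
move: h; rewrite E ler_pdivrMr// => h.
rewrite /noise_form -/N lerBlDr.
have -> : (2 * u + 2 * u ^+ 2) * N + N = y * N by rewrite /y; ring.
by rewrite mulrC ler_pdivrMr// mulrC mulrA.
Qed.

End lattice_chernoff.

(** The choice [u^2 = 5 p / n + delta] turns the exponent [5 p - n u^2] into [- n delta], and keeps
    [u] positive even if [p / n] tends to 0. *)
Lemma ae_noise_operator_le (delta : R) : 0 < delta ->
  {ae P, forall w, \forall n \near \oo,
     let u := Num.sqrt (5 * ((p n)%:R / n%:R) + delta) in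
     forall a : 'I_(p n) -> R,
     n%:R^-1 * \sum_(i < n) (\sum_j a j * z i j w) ^+ 2 <=
     (1 + 81 / 64 * (2 * u + 2 * u ^+ 2) + delta) * \sum_j a j ^+ 2}.
Proof.
move=> d0.
pose u n := Num.sqrt (5 * ((p n)%:R / n%:R) + delta).
have x0 n : 0 < 5 * ((p n)%:R / n%:R) + delta.
  by rewrite ltr_wpDl// mulr_ge0// divr_ge0.
have u0 n : 0 < u n by rewrite sqrtr_gt0.
have : {ae P, forall w, \forall n \near \oo, lattice_chernoff (p n) n (u n) w < 1}.
  apply: (@ae_eventually_lt1 _ _ _ _ _ 1 delta) => //.
  - by move=> n; exact: measurable_lattice_chernoff.
  - by move=> n w; exact: lattice_chernoff_ge0.
  - near=> n; have n0 : (0 < n)%N by near: n; exact: nbhs_infty_gt.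
    apply: le_trans (expectation_lattice_chernoff (p n) n (ltW (u0 n))) _.
    rewrite lee_fin mul1r; apply: le_trans (expR_chernoff_le n0 (ltW d0)).
    rewrite ler_expR /u sqr_sqrtr ?(ltW (x0 n))// mulrDr.
    have -> : n%:R * (5 * ((p n)%:R / n%:R)) = 5 * (p n)%:R :> R.
      by field; rewrite pnatr_eq0 -lt0n.
    by lra.
apply: filterS2 (ae_column_sqr_ge d0) => w Cw Fw; near=> n => /= a.
have n0 : (0 < n)%N by near: n; exact: nbhs_infty_gt.
have F1 : lattice_chernoff (p n) n (u n) w < 1 by near: n.
have hk := lattice_chernoff_lt1 n0 (u0 n) F1.
have y0 : 0 <= 2 * u n + 2 * u n ^+ 2.
  by rewrite addr_ge0// mulr_ge0// ?sqr_ge0// ltW.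
have hz : forall j : 'I_(p n), 1 - delta <= n%:R^-1 * \sum_(i < n) z i j w ^+ 2.
  by near: n.
have := noise_form_le_lattice y0 (ltW d0) hz hk a.
by rewrite /noise_form -/(u n); lra.
Unshelve. all: by end_near. Qed.

End noise_operator_bound.

(** * The cross term *)

Section cross_term_bound.
Context {R : realType} {d : measure_display} {T : measurableType d}
  (P : probability T R) (v : nat -> T -> R) (z : nat -> nat -> T -> R).
Hypothesis normal_v : forall i, std_normal_rv P (v i).
Hypothesis normal_z : forall i j, std_normal_rv P (z i j).
Hypothesis indep_vz : mutually_independent P (model_coord v z).

Section fixed_dimension.
Variables (q n : nat) (r : 'I_q -> R) (be bb : R).

(** With [be = m / g] and [bb = sigma / g] this is the component of [x i] along [r], divided by [g]
    to have variance 1. *)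
Definition signal_coord (i : nat) (w : T) : R :=
  row_form v z be (fun j => bb * r j) i w.

Definition proj_perp (e : 'I_q -> R) (j : 'I_q) : R := e j - (\sum_l e l * r l) * r j.

Definition cross_sum (e : 'I_q -> R) (w : T) : R :=
  \sum_(i < n) row_form v z 0 (proj_perp e) i w * signal_coord i w.

(** Multiplied by [sigma g / n], this is coordinate [j] of [S r - (r^T S r) r]. *)
Definition cross_coord (j : 'I_q) (w : T) : R :=
  \sum_(i < n) (z i j w - r j * \sum_l r l * z i l w) * signal_coord i w.

Lemma cross_sumE e w : cross_sum e w = \sum_j e j * cross_coord j w.
Proof.
rewrite /cross_sum /cross_coord.
under [RHS]eq_bigr do rewrite mulr_sumr.
rewrite exchange_big/=; apply: eq_bigr => i _.
under [RHS]eq_bigr do rewrite mulrA.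
rewrite -mulr_suml; congr (_ * _); rewrite /row_form mul0r add0r.
set rz := \sum_l r l * z i l w.
transitivity (\sum_j e j * z i j w - (\sum_l e l * r l) * rz).
  by rewrite mulr_sumr -sumrB; apply: eq_bigr => j _; rewrite /proj_perp; ring.
by rewrite mulr_suml -sumrB; apply: eq_bigr => j _; ring.
Qed.

Lemma measurable_expR_cross_sum t e : measurable_fun setT (fun w => expR (t * cross_sum e w)).
Proof.
apply: measurableT_comp => //; apply: measurable_funM => //.
by apply: measurable_sum => i; apply: measurable_funM; exact: measurable_row_form.
Qed.

(** Projecting [e] makes its noise form uncorrelated with the signal coordinate and does not
    increase the norm, so a bound on [e] itself is enough. *)
Lemma expectation_cross_sum e a0 theta :
  \sum_j r j ^+ 2 = 1 -> be ^+ 2 + bb ^+ 2 = 1 -> 0 < a0 ->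
  \sum_j e j ^+ 2 <= a0 ^+ 2 -> 0 <= theta -> theta * a0 <= 1 / 40 ->
  (\int[P]_w (expR (theta * cross_sum e w))%:E <=
   (expR (n%:R * (6 / 5 * (theta * a0) ^+ 2)))%:E)%E.
Proof.
move=> r1 b1 a0p ea th0 tha.
set er := \sum_l e l * r l.
apply: (expectation_expR_sum_mul normal_v normal_z indep_vz) => //.
- apply: le_trans ea.
  have -> : \sum_j proj_perp e j ^+ 2 = \sum_j e j ^+ 2 - er ^+ 2.
    transitivity (\sum_j e j ^+ 2 - \sum_j 2 * er * (e j * r j) + \sum_j er ^+ 2 * r j ^+ 2).
      by rewrite -sumrB -big_split/=; apply: eq_bigr => j _; rewrite /proj_perp -/er; ring.
    by rewrite -!mulr_sumr r1 -/er; ring.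
  by rewrite gerBl sqr_ge0.
- transitivity (\sum_j bb * (e j * r j) - \sum_j bb * er * r j ^+ 2).
    by rewrite -sumrB; apply: eq_bigr => j _; rewrite /proj_perp -/er; ring.
  by rewrite -!mulr_sumr r1 -/er mulr1 subrr.
- by under eq_bigr do rewrite exprMn; rewrite -mulr_sumr r1 mulr1.
Qed.

Definition signv (s : bool) : R := (-1) ^+ s.

Lemma signv_sqr s : signv s ^+ 2 = 1.
Proof. by rewrite /signv sqrr_sign. Qed.

(** A union bound over signed coordinates: parameter [1 / (10 h)] and threshold [3/100 h^2] together
    enforce [|cross_coord j| <= 3/10 h^3]. *)
Definition cross_coord_chernoff (h : R) (w : T) : R :=
  \sum_(js : 'I_q * bool) expR (- (3 / 100 * h ^+ 2)) *
    expR ((10 * h)^-1 * cross_sum (fun l => signv js.2 * (l == js.1)%:R) w).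

(* Averaging over the signs turns the exponential of [h / n] times the cross sum
   into the product of [cosh (h / n * cross_coord j)], comparable with the
   exponential of half the sum of squares once every factor is close to 1; this
   closeness is what [cross_coord_chernoff] provides. *)
Definition cross_sign_chernoff (h delta : R) (w : T) : R :=
  \sum_(ep : {ffun 'I_q -> bool})
    (2^-1 ^+ q * expR (- (h ^+ 2 * (6 / 5 * (q%:R / n%:R) + delta)))) *
    expR (h / n%:R * cross_sum (fun l => signv (ep l)) w).

Lemma measurable_cross_coord_chernoff h : measurable_fun setT (cross_coord_chernoff h).
Proof.
by apply: measurable_sum => k; apply: measurable_funM => //; exact: measurable_expR_cross_sum.
Qed.

Lemma measurable_cross_sign_chernoff h delta :
  measurable_fun setT (cross_sign_chernoff h delta).
Proof.
by apply: measurable_sum => k; apply: measurable_funM => //; exact: measurable_expR_cross_sum.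
Qed.

Lemma cross_coord_chernoff_ge0 h w : 0 <= cross_coord_chernoff h w.
Proof. by apply: sumr_ge0 => k _; rewrite mulr_ge0 ?expR_ge0. Qed.

Lemma cross_sign_chernoff_ge0 h delta w : 0 <= cross_sign_chernoff h delta w.
Proof.
by apply: sumr_ge0 => k _; rewrite !mulr_ge0 ?expR_ge0// exprn_ge0// invr_ge0.
Qed.

Hypothesis r1 : \sum_j r j ^+ 2 = 1.
Hypothesis b1 : be ^+ 2 + bb ^+ 2 = 1.

(** The moment contributes [6/500 h^2] against the threshold [15/500 h^2]; [4 <= h] puts the
    parameter [1 / (10 h)] below [1 / 40]. *)
Lemma expectation_cross_coord_chernoff h : 4 <= h -> h ^+ 4 = n%:R ->
  (\int[P]_w (cross_coord_chernoff h w)%:E <=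
   (2 * q%:R * expR (- (9 / 500 * h ^+ 2)))%:E)%E.
Proof.
move=> h4 hn; have h0 : 0 < h by lra.
apply: (@le_trans _ _ (\sum_(js : 'I_q * bool) expR (- (3 / 100 * h ^+ 2)) *
    expR (n%:R * (6 / 5 * ((10 * h)^-1 * 1) ^+ 2)))%:E).
  apply: le_integral_wsum.
  - by move=> k; exact: measurable_expR_cross_sum.
  - by move=> k w; exact: expR_ge0.
  - by move=> k; exact: expR_ge0.
  - move=> [j s] _; apply: expectation_cross_sum => //=.
    + rewrite expr1n; under eq_bigr do rewrite exprMn signv_sqr mul1r.
      by have := sum_sqr_unit (R := R) j; rewrite expr0n add0r => ->.
    + by rewrite invr_ge0 mulr_ge0// ltW.
    + rewrite mulr1 -[leLHS]mul1r ler_pdivrMr ?mulr_gt0//; lra.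
rewrite lee_fin sumr_const card_prod card_ord card_bool.
rewrite -expRD -[leLHS]mulr_natl natrM mulrC [X in _ * X]mulrC mulrC.
rewrite ler_wpM2l ?mulr_ge0// ler_expR mulr1 -hn.
have -> : h ^+ 4 * (6 / 5 * (10 * h)^-1 ^+ 2) = 6 / 500 * h ^+ 2.
  by field; exact: lt0r_neq0.
by have := sqr_ge0 h; lra.
Qed.

(** All sign vectors have squared norm [q], so every term obeys the same bound and averaging over
    signs costs nothing. *)
Lemma expectation_cross_sign_chernoff h delta : (0 < q)%N -> 0 < h ->
  h ^+ 4 = n%:R -> h / n%:R * Num.sqrt q%:R <= 1 / 40 ->
  (\int[P]_w (cross_sign_chernoff h delta w)%:E <=
   (expR (- (delta * h ^+ 2)))%:E)%E.
Proof.
move=> q0 h0 hn hq.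
have n0 : 0 < n%:R :> R by rewrite -hn exprn_gt0.
have qR : 0 < q%:R :> R by rewrite ltr0n.
pose u := n%:R * (6 / 5 * (h / n%:R * Num.sqrt q%:R) ^+ 2).
apply: (@le_trans _ _ (\sum_(ep : {ffun 'I_q -> bool})
  (2^-1 ^+ q * expR (- (h ^+ 2 * (6 / 5 * (q%:R / n%:R) + delta)))) * expR u)%:E).
  apply: le_integral_wsum.
  - by move=> k; exact: measurable_expR_cross_sum.
  - by move=> k w; exact: expR_ge0.
  - by move=> k; rewrite mulr_ge0 ?expR_ge0// exprn_ge0// invr_ge0.
  - move=> ep _; apply: expectation_cross_sum => //=.
    + by rewrite sqrtr_gt0.
    + under eq_bigr do rewrite signv_sqr.
      by rewrite sumr_const card_ord sqr_sqrtr.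
    + by rewrite divr_ge0// ltW.
rewrite lee_fin sumr_const card_ffun card_bool card_ord.
rewrite -[leLHS]mulr_natl natrX !mulrA -exprMn divff ?pnatr_eq0// expr1n mul1r -expRD ler_expR.
have -> : u = h ^+ 2 * (6 / 5 * (q%:R / n%:R)).
  rewrite /u exprMn sqr_sqrtr ?ltW//; field; exact: lt0r_neq0.
by lra.
Qed.

(** Since [|x j| <= 3/10], each [cosh (x j) >= 1 + x j^2 / 2] is at least [exp (19/20 * x j^2 / 2)].
    The product being controlled, the sum [S] satisfies [19/40 S <= 6/5 q / n + delta], and
    [48/19 <= 64/25 = (8/5)^2]. *)
Lemma cross_chernoff_lt1 h delta w : 0 < h -> h ^+ 4 = n%:R -> 0 <= delta ->
  cross_coord_chernoff h w < 1 -> cross_sign_chernoff h delta w < 1 ->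
  \sum_j (cross_coord j w / n%:R) ^+ 2 <= 64 / 25 * (q%:R / n%:R + delta).
Proof.
move=> h0 hn d0 F4 F3.
have n0 : 0 < n%:R :> R by rewrite -hn exprn_gt0.
have h20 : 0 < h ^+ 2 by rewrite exprn_gt0.
pose x j := h / n%:R * cross_coord j w.
have cs s j : cross_sum (fun l => signv s * (l == j)%:R) w = signv s * cross_coord j w.
  rewrite cross_sumE (bigD1 j)//= eqxx mulr1 big1 ?addr0// => l /negbTE ->.
  by rewrite mulr0 mul0r.
have cc s j : signv s * cross_coord j w <= 3 / 10 * h ^+ 3.
  have : expR (- (3 / 100 * h ^+ 2)) *
    expR ((10 * h)^-1 * cross_sum (fun l => signv s * (l == j)%:R) w) < 1.
    apply: le_lt_trans F4; rewrite /cross_coord_chernoff (bigD1 (j, s))//= lerDl.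
    by apply: sumr_ge0 => k _; rewrite mulr_ge0 ?expR_ge0.
  rewrite -expRD expR_lt1 cs => hh.
  have : (10 * h)^-1 * (signv s * cross_coord j w) <= 3 / 100 * h ^+ 2 by lra.
  rewrite mulrC ler_pdivrMr ?mulr_gt0// => {}hh; apply: le_trans hh _.
  by rewrite le_eqVlt; apply/orP; left; apply/eqP; field.
have xs j : x j ^+ 2 / 2 <= 1 / 20.
  have : `|cross_coord j w| <= 3 / 10 * h ^+ 3.
    have := cc false j; have := cc true j; rewrite /signv expr1 expr0 mul1r mulN1r.
    by rewrite ler_norml; lra.
  move=> hh; have : `|x j| <= 3 / 10.
    rewrite /x normrM ger0_norm; last by rewrite divr_ge0// ltW.
    apply: (@le_trans _ _ (h / n%:R * (3 / 10 * h ^+ 3))).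
      by rewrite ler_wpM2l// divr_ge0// ltW.
    rewrite -hn; rewrite le_eqVlt; apply/orP; left; apply/eqP; field; exact: lt0r_neq0.
  have := real_normK (num_real (x j)); have := normr_ge0 (x j); nra.
have prodE : \prod_j ((expR (x j) + expR (- x j)) / 2) =
    \sum_(ep : {ffun 'I_q -> bool}) 2^-1 ^+ q *
      expR (h / n%:R * cross_sum (fun l => signv (ep l)) w).
  rewrite big_split/= prodr_const card_ord mulrC -mulr_sumr; congr (_ * _).
  transitivity (\prod_(j < q) \sum_(s : bool) expR (signv s * x j)).
    by apply: eq_bigr => j _; rewrite big_bool/= addrC /signv expr0 expr1 mul1r mulN1r.
  rewrite bigA_distr_bigA; apply: eq_bigr => ep _.
  rewrite -expR_sum cross_sumE mulr_sumr; congr expR; apply: eq_bigr => j _.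
  by rewrite /x; ring.
have low : expR (19 / 20 * (\sum_j x j ^+ 2 / 2)) <= \prod_j ((expR (x j) + expR (- x j)) / 2).
  rewrite mulr_sumr expR_sum; apply: ler_prod => j _; rewrite expR_ge0/=.
  have x0 : 0 <= x j ^+ 2 / 2 by rewrite divr_ge0// sqr_ge0.
  apply: le_trans (expR_le1D x0 (xs j)) _.
  by have := cosh_ge (x j); lra.
have : expR (19 / 20 * (\sum_j x j ^+ 2 / 2) - h ^+ 2 * (6 / 5 * (q%:R / n%:R) + delta)) < 1.
  apply: le_lt_trans F3; rewrite expRD /cross_sign_chernoff.
  have -> : \sum_(ep : {ffun 'I_q -> bool})
    2^-1 ^+ q * expR (- (h ^+ 2 * (6 / 5 * (q%:R / n%:R) + delta))) *
    expR (h / n%:R * cross_sum (fun l => signv (ep l)) w) =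
    (\prod_j ((expR (x j) + expR (- x j)) / 2)) *
      expR (- (h ^+ 2 * (6 / 5 * (q%:R / n%:R) + delta))).
    by rewrite prodE mulr_suml; apply: eq_bigr => ep _; rewrite mulrAC.
  by rewrite ler_wpM2r ?expR_ge0.
rewrite expR_lt1.
have -> : \sum_j x j ^+ 2 / 2 = h ^+ 2 * ((\sum_j (cross_coord j w / n%:R) ^+ 2) / 2).
  by rewrite mulr_suml mulr_sumr; apply: eq_bigr => j _; rewrite /x !exprMn; ring.
set S := \sum_j _; set y := q%:R / n%:R => hh.
have y0 : 0 <= y by rewrite divr_ge0.
have : h ^+ 2 * (19 / 40 * S) <= h ^+ 2 * (6 / 5 * y + delta) by lra.
by rewrite ler_pM2l//; lra.
Qed.

End fixed_dimension.

Variables (p : nat -> nat) (c : R).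
Hypothesis p_cvg : (fun n : nat => (p n)%:R / n%:R : R) @ \oo --> c.

Lemma ae_cross_coord_le (r : forall n, 'I_(p n) -> R) (be bb : nat -> R) (delta : R) :
  0 < delta ->
  (\forall n \near \oo, (0 < p n)%N) ->
  (\forall n \near \oo, \sum_j r n j ^+ 2 = 1) ->
  (\forall n \near \oo, be n ^+ 2 + bb n ^+ 2 = 1) ->
  {ae P, forall w, \forall n \near \oo,
     \sum_j (cross_coord n (r n) (be n) (bb n) j w / n%:R) ^+ 2 <=
     64 / 25 * ((p n)%:R / n%:R + delta)}.
Proof.
move=> d0 p0 r1 b1.
pose h n : R := Num.sqrt (Num.sqrt n%:R).
have h2 n : h n ^+ 2 = Num.sqrt n%:R by rewrite sqr_sqrtr.
have h4 n : h n ^+ 4 = n%:R by rewrite -[4%N]/(2 * 2)%N exprM h2 sqr_sqrtr.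
have hge (A : R) : 0 <= A -> \forall n \near \oo, A <= h n.
  move=> A0; near=> n.
  rewrite -(@ler_pXn2r _ 4)// ?nnegrE ?sqrtr_ge0// h4; near: n; exact: nbhs_infty_ger.
have F4 : {ae P, forall w, \forall n \near \oo,
    cross_coord_chernoff n (r n) (be n) (bb n) (h n) w < 1}.
  apply: (@ae_eventually_lt1 _ _ _ _ _ (2 * (c + 1)) (9 / 500)).
  - by rewrite divr_gt0.
  - by move=> n; exact: measurable_cross_coord_chernoff.
  - by move=> n w; exact: cross_coord_chernoff_ge0.
  - near=> n; apply: le_trans (expectation_cross_coord_chernoff _ _ _ _) _ => //.
    + by near: n.
    + by near: n.
    + by near: n; exact: hge.
    rewrite lee_fin h2 -!mulrA ler_wpM2l// [leRHS]mulrA ler_wpM2r ?expR_ge0//.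
    by near: n; exact: p_near_le.
have F3 : {ae P, forall w, \forall n \near \oo,
    cross_sign_chernoff n (r n) (be n) (bb n) (h n) delta w < 1}.
  apply: (@ae_eventually_lt1 _ _ _ _ _ 1 delta) => //.
  - by move=> n; exact: measurable_cross_sign_chernoff.
  - by move=> n w; exact: cross_sign_chernoff_ge0.
  - near=> n.
    have n0 : 0 < n%:R :> R by rewrite ltr0n; near: n; exact: nbhs_infty_gt.
    have hn0 : 0 < h n by rewrite !sqrtr_gt0.
    have pn : (p n)%:R <= (c + 1) * n%:R by near: n; exact: p_near_le.
    have c1 : 0 <= c + 1 by rewrite -(pmulr_lge0 _ n0); exact: le_trans pn.
    apply: le_trans (expectation_cross_sign_chernoff _ _ _ _ _ _ _) _ => //.
    + by near: n.
    + by near: n.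
    + by near: n.
    (* As [sqrt p] is at most [(c + 2) h^2], the quantity to bound is at most [(c + 2) / h], which
       tends to 0. *)
    + have hb : 40 * (`|c| + 2) <= h n by near: n; apply: hge; rewrite mulr_ge0// addr_ge0.
      have sq : Num.sqrt (p n)%:R <= (c + 2) * h n ^+ 2.
        have c2 : 0 <= c + 2 by lra.
        have k0 : 0 <= (c + 2) * h n ^+ 2 by rewrite mulr_ge0// sqr_ge0.
        rewrite -[leRHS](ger0_norm k0) -sqrtr_sqr ler_sqrt ?sqr_ge0//.
        rewrite exprMn -exprM h4; apply: le_trans pn _; rewrite ler_wpM2r//; nra.
      apply: (@le_trans _ _ (h n / n%:R * ((c + 2) * h n ^+ 2))).
        by rewrite ler_wpM2l// divr_ge0// ltW.
      rewrite -[in leLHS](h4 n).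
      have -> : h n / h n ^+ 4 * ((c + 2) * h n ^+ 2) = (c + 2) / h n.
        by field; exact: lt0r_neq0.
      by rewrite ler_pdivrMr//; have := ler_norm c; lra.
    rewrite lee_fin mul1r h2 -[leLHS]mul1r ler_wpM2r ?expR_ge0//.
    by rewrite ler1n; near: n; exact: nbhs_infty_gt.
apply: filterS2 F4 F3 => w F4w F3w; near=> n.
have n0 : 0 < n%:R :> R by rewrite ltr0n; near: n; exact: nbhs_infty_gt.
apply: (@cross_chernoff_lt1 _ _ _ _ _ (h n)); rewrite ?sqrtr_gt0 ?(ltW d0)//.
- by near: n.
- by near: n.
Unshelve. all: by end_near. Qed.

End cross_term_bound.

(** * The limiting bound *)

Section limiting_bound.
Context {R : realType}.

(** In this and the next two definitions [m], [x] and [delta] stand for [|rho|], [p / n] and the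
    slack; kept as free arguments, they allow [n] and then [delta] to be sent to the limit by
    continuity. *)
Definition noise_level (x delta : R) : R :=
  let u := Num.sqrt (5 * x + delta) in
  1 + 81 / 64 * (2 * u + 2 * u ^+ 2) + delta.

Definition gap (sigma m x delta : R) : R :=
  (1 - delta) * (m ^+ 2 + sigma ^+ 2) - sigma ^+ 2 * noise_level x delta.

Definition angle_bound (sigma m x delta : R) : R :=
  Num.sqrt (64 / 25 * (x + delta)) * (sigma * Num.sqrt (m ^+ 2 + sigma ^+ 2)) /
  gap sigma m x delta.

Lemma cvg_sqr (U : Type) (F : set_system U) {FF : Filter F} (m : U -> R) (m0 : R) :
  m @ F --> m0 -> (fun i => m i ^+ 2) @ F --> m0 ^+ 2.
Proof. by move=> cm; under eq_fun do rewrite expr2; rewrite expr2; exact: cvgM. Qed.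

Lemma gap_cvg (U : Type) (F : set_system U) {FF : Filter F} (sigma : R)
    (m x e : U -> R) (m0 x0 e0 : R) :
  m @ F --> m0 -> x @ F --> x0 -> e @ F --> e0 ->
  (fun i => gap sigma (m i) (x i) (e i)) @ F --> gap sigma m0 x0 e0.
Proof.
move=> cm cx ce.
have cu : (fun i => Num.sqrt (5 * x i + e i)) @ F --> Num.sqrt (5 * x0 + e0).
  apply: (@cvg_comp _ _ _ (fun i => 5 * x i + e i) Num.sqrt); last exact: sqrt_continuous.
  exact: (cvgD (cvgM (cvg_cst _) cx) ce).
have cm2 := cvg_sqr (FF := FF) cm; have cu2 := cvg_sqr (FF := FF) cu.
have cc (k : R) : (fun _ : U => k) @ F --> k by exact: cvg_cst.
have cN : (fun i => noise_level (x i) (e i)) @ F --> noise_level x0 e0.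
  have := cvgD (cvgD (cc 1) (cvgM (cc (81 / 64)) (cvgD (cvgM (cc 2) cu) (cvgM (cc 2) cu2)))) ce.
  exact.
have := cvgB (cvgM (cvgB (cc 1) ce) (cvgD cm2 (cc (sigma ^+ 2)))) (cvgM (cc (sigma ^+ 2)) cN).
exact.
Qed.

Lemma angle_bound_cvg (U : Type) (F : set_system U) {FF : Filter F} (sigma : R)
    (m x e : U -> R) (m0 x0 e0 : R) : gap sigma m0 x0 e0 != 0 ->
  m @ F --> m0 -> x @ F --> x0 -> e @ F --> e0 ->
  (fun i => angle_bound sigma (m i) (x i) (e i)) @ F --> angle_bound sigma m0 x0 e0.
Proof.
move=> g0 cm cx ce; rewrite /angle_bound; apply: cvgM; last first.
  by apply: cvgV => //; exact: gap_cvg.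
apply: cvgM.
  apply: (@cvg_comp _ _ _ (fun i => 64 / 25 * (x i + e i)) Num.sqrt); last exact: sqrt_continuous.
  exact: (cvgM (cvg_cst _) (cvgD cx ce)).
apply: cvgM; first exact: cvg_cst.
apply: (@cvg_comp _ _ _ (fun i => m i ^+ 2 + sigma ^+ 2) Num.sqrt); last exact: sqrt_continuous.
exact: (cvgD (cvg_sqr (FF := FF) cm) (cvg_cst _)).
Qed.

(** The hypothesis reads [4 s (tau + 2 + s) <= tau^2], whence [4 s <= tau]. With
    [kap <= s (5.7 + 12.7 s)], it also gives [4 (tau + 2 + s) kap <= tau^2 (5.7 + 12.7 s)], and
    bounding the root by [tau + 1] leaves the linear inequality [8.7 s <= 2.4 tau + 0.7]. *)
Lemma zeta_dominates (tau s : R) : 0 < tau -> 0 <= s ->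
  4 * s / tau * (1 + (2 + s) / tau) <= 1 ->
  let kap := 81 / 64 * (2 * (Num.sqrt 5 * s) + 10 * s ^+ 2) in
  kap < tau ^+ 2 /\
  8 / 5 * s * Num.sqrt (tau ^+ 2 + 1) <=
    4 * s / tau * (1 + (2 + s) / tau) * (tau ^+ 2 - kap).
Proof.
move=> t0 s0; have -> : 4 * s / tau * (1 + (2 + s) / tau) = 4 * s * (tau + 2 + s) / tau ^+ 2.
  by field; exact: lt0r_neq0.
have t20 : 0 < tau ^+ 2 by rewrite exprn_gt0.
rewrite ler_pdivrMr// mul1r => h; set kap := _ * _.
have q5 : Num.sqrt 5 <= 224 / 100 :> R.
  have k0 : 0 <= 224 / 100 :> R by rewrite divr_ge0.
  rewrite -[leRHS](ger0_norm k0) -sqrtr_sqr ler_sqrt ?sqr_ge0//; lra.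
have kap_le : kap <= s * (57 / 10 + 127 / 10 * s) by rewrite /kap; nra.
have t4 : 4 * s <= tau.
  rewrite leNgt; apply/negP => ts; nra.
have [s00|sn] := eqVneq s 0.
  have k0 : kap <= 0 by rewrite (le_trans kap_le)// s00 mul0r.
  by split; [lra|rewrite s00 !(mulr0, mul0r)].
have sp : 0 < s by rewrite lt0r sn.
have sq1 : Num.sqrt (tau ^+ 2 + 1) <= tau + 1.
  have k0 : 0 <= tau + 1 by lra.
  rewrite -[leRHS](ger0_norm k0) -sqrtr_sqr ler_sqrt ?sqr_ge0//; nra.
split.
  apply: le_lt_trans kap_le _; apply: lt_le_trans h.
  have -> : 4 * s * (tau + 2 + s) = s * (4 * (tau + 2 + s)) by ring.
  by rewrite ltr_pM2l//; lra.
apply: (@le_trans _ _ (8 / 5 * s * (tau + 1))).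
  by rewrite ler_wpM2l// mulr_ge0// divr_ge0.
rewrite [leRHS]mulrAC ler_pdivlMr//.
have -> : 8 / 5 * s * (tau + 1) * tau ^+ 2 = s * (tau ^+ 2 * (8 / 5 * (tau + 1))) by ring.
have -> : 4 * s * (tau + 2 + s) * (tau ^+ 2 - kap) =
  s * (tau ^+ 2 * (4 * (tau + 2 + s)) - 4 * (tau + 2 + s) * kap) by ring.
rewrite ler_pM2l// lerBrDr -lerBrDl.
apply: (@le_trans _ _ (tau ^+ 2 * (57 / 10 + 127 / 10 * s))).
  apply: (@le_trans _ _ (4 * (tau + 2 + s) * (s * (57 / 10 + 127 / 10 * s)))).
    by rewrite ler_wpM2l//; lra.
  have -> : 4 * (tau + 2 + s) * (s * (57 / 10 + 127 / 10 * s)) =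
    4 * s * (tau + 2 + s) * (57 / 10 + 127 / 10 * s) by ring.
  by rewrite ler_wpM2r//; lra.
by rewrite -mulrBr ler_pM2l//; lra.
Qed.

Lemma angle_bound0_le_zeta (sigma varrho c : R) : 0 < sigma -> 0 < varrho -> 0 <= c ->
  zeta (varrho / sigma) c <= 1 ->
  0 < gap sigma varrho c 0 /\ angle_bound sigma varrho c 0 <= zeta (varrho / sigma) c.
Proof.
move=> s0 v0 c0 z1.
have [k1 k2] := zeta_dominates (divr_gt0 v0 s0) (sqrtr_ge0 c) z1.
rewrite -/(zeta (varrho / sigma) c) in k2.
set tau := varrho / sigma in k1 k2 z1 *; set s := Num.sqrt c in k1 k2.
set kap := 81 / 64 * _ in k1 k2.
have s2 : s ^+ 2 = c by rewrite sqr_sqrtr.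
have vt : varrho = tau * sigma by rewrite /tau divfK// gt_eqF.
have gE : gap sigma varrho c 0 = sigma ^+ 2 * (tau ^+ 2 - kap).
  rewrite /gap /noise_level !addr0 sqrtrM// -/s exprMn sqr_sqrtr// s2 /kap s2 vt.
  by field.
have g0 : 0 < gap sigma varrho c 0 by rewrite gE mulr_gt0 ?exprn_gt0// subr_gt0.
split => //; rewrite /angle_bound ler_pdivrMr// gE addr0.
have -> : Num.sqrt (64 / 25 * c) = 8 / 5 * s.
  rewrite sqrtrM ?divr_ge0//; congr (_ * _).
  have k0 : 0 <= 8 / 5 :> R by rewrite divr_ge0.
  by rewrite -[RHS](ger0_norm k0) -sqrtr_sqr; congr Num.sqrt; field.
have -> : Num.sqrt (varrho ^+ 2 + sigma ^+ 2) = sigma * Num.sqrt (tau ^+ 2 + 1).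
  have -> : varrho ^+ 2 + sigma ^+ 2 = sigma ^+ 2 * (tau ^+ 2 + 1) by rewrite vt; ring.
  by rewrite sqrtrM ?sqr_ge0// sqrtr_sqr gtr0_norm.
have -> : 8 / 5 * s * (sigma * (sigma * Num.sqrt (tau ^+ 2 + 1))) =
  sigma ^+ 2 * (8 / 5 * s * Num.sqrt (tau ^+ 2 + 1)) by ring.
by rewrite [leRHS]mulrCA ler_pM2l ?exprn_gt0.
Qed.

End limiting_bound.

(** * Deterministic passage from the three events to the angle *)

Section angle_bound_of_events.
Context {R : realType}.

Lemma limn_esup_le_near (u : nat -> \bar R) (M : \bar R) :
  (\forall n \near \oo, (u n <= M)%E) -> (limn_esup u <= M)%E.
Proof.
move=> [N _ H]; rewrite limn_esup_lim.
apply: lime_le; first exact: is_cvg_esups.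
exists N => // n Nn; apply: ge_ereal_sup => _ [k /= nk <-].
by apply: H; exact: leq_trans nk.
Qed.

Context {d : measure_display} {T : measurableType d} (v : nat -> T -> R)
  (z : nat -> nat -> T -> R).
Variables (q n : nat) (w : T) (rho : 'cV[R]_q) (sigma : R).
Hypothesis n_gt0 : (0 < n)%N.
Hypothesis rho_neq0 : rho != 0.
Hypothesis sigma_gt0 : 0 < sigma.

Let m := vnorm rho.
Let g := Num.sqrt (m ^+ 2 + sigma ^+ 2).
Let r : 'cV[R]_q := m^-1 *: rho.
Let x (i : nat) : 'cV[R]_q := \col_(j < q) (v i w * rho j 0 + sigma * z i j w).
Let S : 'M[R]_q := n%:R^-1 *: \sum_(i < n) (x i *m (x i)^T).
Let s (i : nat) : R := signal_coord v z (fun j => r j 0) (m / g) (sigma / g) i w.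

Let rr_gt0 : 0 < dotv rho rho.
Proof. by rewrite lt0r dotv_eq0 rho_neq0 dotv_ge0. Qed.

Let m_gt0 : 0 < m. Proof. by rewrite sqrtr_gt0. Qed.

Let m2s2_gt0 : 0 < m ^+ 2 + sigma ^+ 2.
Proof. by rewrite addr_gt0// exprn_gt0. Qed.

Let g_gt0 : 0 < g. Proof. by rewrite sqrtr_gt0. Qed.

Let g2 : g ^+ 2 = m ^+ 2 + sigma ^+ 2. Proof. by rewrite sqr_sqrtr// ltW. Qed.

Lemma unit_direction : dotv r r = 1.
Proof.
rewrite /r dotvZl dotvZr mulrA -expr2 exprVn /m /vnorm sqr_sqrtr ?dotv_ge0//.
by rewrite mulVf// gt_eqF.
Qed.

Lemma sum_sqr_direction : \sum_j r j 0 ^+ 2 = 1.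
Proof. by rewrite -unit_direction dotvE; apply: eq_bigr => j _; rewrite expr2. Qed.

Lemma signal_weights : (m / g) ^+ 2 + (sigma / g) ^+ 2 = 1.
Proof. by rewrite !exprMn -mulrDl -g2 -exprMn divff ?expr1n// gt_eqF. Qed.

Let rhoE : rho = m *: r.
Proof. by rewrite /r scalerA divff ?scale1r// gt_eqF. Qed.

Let dot_rho a : dotv a rho = m * dotv a r.
Proof. by rewrite {1}rhoE dotvZr. Qed.

Let dotx (a : 'cV[R]_q) i :
  dotv a (x i) = v i w * dotv a rho + sigma * \sum_j a j 0 * z i j w.
Proof.
rewrite !dotvE !mulr_sumr -big_split/=; apply: eq_bigr => j _; rewrite mxE; ring.
Qed.

Let dot_rx i : dotv r (x i) = g * s i.
Proof.
rewrite dotx dot_rho unit_direction mulr1 /s /signal_coord /row_form mulrDr.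
congr (_ + _); first by field; exact: lt0r_neq0.
rewrite !mulr_sumr; apply: eq_bigr => j _; field; exact: lt0r_neq0.
Qed.

Let mulSE (b : 'cV[R]_q) j : (S *m b) j 0 = n%:R^-1 * \sum_(i < n) x i j 0 * dotv b (x i).
Proof.
rewrite /S -scalemxAl mxE mulmx_suml summxE; congr (_ * _); apply: eq_bigr => i _.
by rewrite -mulmxA mxE big_ord1; congr (_ * _); rewrite dotvC.
Qed.

Let dotS (a b : 'cV[R]_q) :
  dotv a (S *m b) = n%:R^-1 * \sum_(i < n) dotv a (x i) * dotv b (x i).
Proof.
rewrite dotvE; under eq_bigr do rewrite mulSE mulrCA mulr_sumr.
rewrite -mulr_sumr exchange_big/=; congr (_ * _); apply: eq_bigr => i _.
by rewrite (dotvE a) mulr_suml; apply: eq_bigr => j _; rewrite mulrA.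
Qed.

Lemma sample_cov_sym : S^T = S.
Proof.
rewrite /S linearZ/= linear_sum/=; congr (_ *: _); apply: eq_bigr => i _.
by rewrite trmx_mul trmxK.
Qed.

Lemma sin_angle_le (u : 'cV[R]_q) (delta : R) : (0 < q)%N ->
  top_unit_eigvec S u -> 0 <= delta -> 0 < gap sigma m (q%:R / n%:R) delta ->
  (1 - delta) * n%:R <= \sum_(i < n) s i ^+ 2 ->
  (forall a : 'I_q -> R, n%:R^-1 * \sum_(i < n) (\sum_j a j * z i j w) ^+ 2 <=
     noise_level (q%:R / n%:R) delta * \sum_j a j ^+ 2) ->
  \sum_j (cross_coord v z n (fun j => r j 0) (m / g) (sigma / g) j w / n%:R) ^+ 2 <=
    64 / 25 * (q%:R / n%:R + delta) ->
  sin (vangle u rho) <= angle_bound sigma m (q%:R / n%:R) delta.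
Proof.
move=> q0 [u1 [lam [Su top]]] d0 gap0 H1 H2 H3.
have nR : 0 < n%:R :> R by rewrite ltr0n.
have uu : dotv u u = 1.
  by rewrite -(sqr_sqrtr (dotv_ge0 u)) -/(vnorm u) u1 expr1n.
have xd0 : 0 <= 64 / 25 * (q%:R / n%:R + delta).
  by rewrite mulr_ge0// ?addr_ge0// divr_ge0.
rewrite sin_vangle// -/m -/r.
apply: (@perturbed_eigenvector_bound _ _ S u r lam ((1 - delta) * (m ^+ 2 + sigma ^+ 2))
  (sigma ^+ 2 * noise_level (q%:R / n%:R) delta)) => //.
- exact: sample_cov_sym.
- exact: unit_direction.
- apply: (@le_trans _ _ (dotv r (S *m r))); last first.
    have := rayleigh_le_top_eigenvalue sample_cov_sym q0 top r.
    by rewrite unit_direction mulr1.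
  rewrite dotS; under eq_bigr do rewrite dot_rx -expr2 exprMn.
  rewrite -mulr_sumr g2 mulrCA [leLHS]mulrC ler_pM2l// mulrC ler_pdivlMr//.
- move=> a ar; rewrite dotS.
  (* Orthogonally to [r] the signal vanishes, so [S] acts there as pure noise. *)
  have ax i : dotv a (x i) = sigma * \sum_j a j 0 * z i j w.
    by rewrite dotx dot_rho ar mulr0 mulr0 add0r.
  under eq_bigr do rewrite ax -expr2 exprMn.
  rewrite -mulr_sumr mulrCA -mulrA ler_pM2l ?exprn_gt0//.
  apply: le_trans (H2 (fun j => a j 0)) _.
  by rewrite dotvE; under [in leRHS]eq_bigr do rewrite -expr2.
- by rewrite -subr_gt0.
- by rewrite mulr_ge0 ?sqrtr_ge0// mulr_ge0 ?sqrtr_ge0// ltW.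
- rewrite /= -/g; set b := (S *m r - _).
  have bj j : b j 0 = sigma * g *
     (cross_coord v z n (fun j => r j 0) (m / g) (sigma / g) j w / n%:R).
    have -> : b j 0 = (S *m r) j 0 - dotv r (S *m r) * r j 0.
      by rewrite [LHS]mxE; congr (_ + _); rewrite [LHS]mxE; congr (- _); rewrite [LHS]mxE.
    have key : \sum_(i < n) x i j 0 * dotv r (x i) -
        (\sum_(i < n) dotv r (x i) * dotv r (x i)) * r j 0 =
        sigma * g * cross_coord v z n (fun j => r j 0) (m / g) (sigma / g) j w.
      rewrite mulr_suml -sumrB /cross_coord mulr_sumr; apply: eq_bigr => i _.
      (* Splits [x i] into its part along [r] and projected noise; the first part cancels against
         [(r^T S r) r]. *)
      have xj : x i j 0 = r j 0 * (g * s i) + sigma * (z i j w - r j 0 * \sum_l r l 0 * z i l w).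
        have rj : rho j 0 = m * r j 0 by rewrite {1}rhoE mxE.
        by rewrite -dot_rx dotx dot_rho unit_direction mxE rj; ring.
      by rewrite !dot_rx xj -/(s i); ring.
    rewrite mulSE dotS -[X in _ - X]mulrA -[LHS]mulrBr key; ring.
  rewrite dotvE; under eq_bigr do rewrite bj -expr2 exprMn.
  rewrite -mulr_sumr [leRHS]exprMn sqr_sqrtr// [leRHS]mulrC.
  by rewrite ler_pM2l// exprn_gt0// mulr_gt0.
Qed.

End angle_bound_of_events.

Theorem theorem1 (R : realType) (d : measure_display) (T : measurableType d)
  (P : probability T R)
  (p : nat -> nat) (rho : forall n : nat, 'cV[R]_(p n))
  (sigma c varrho : R)
  (v : nat -> T -> R) (z : nat -> nat -> T -> R)
  (rho_hat : forall n : nat, T -> 'cV[R]_(p n)) :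
  0 < sigma ->
  (forall i, std_normal_rv P (v i)) ->
  (forall i j, std_normal_rv P (z i j)) ->
  mutually_independent P
    (fun k : nat + (nat * nat) =>
       match k with inl i => v i | inr ij => z ij.1 ij.2 end) ->
  0 <= c ->
  (fun n : nat => (p n)%:R / n%:R : R) @ \oo --> c ->
  0 < varrho ->
  (fun n : nat => vnorm (rho n)) @ \oo --> varrho ->
  (forall (n : nat) (w : T), (0 < p n)%N ->
     let x := fun i : nat => \col_(j < p n) (v i w * rho n j 0 + sigma * z i j w) in
     let S := n%:R^-1 *: \sum_(i < n) (x i *m (x i)^T) in
     top_unit_eigvec S (rho_hat n w)) ->
  zeta (varrho / sigma) c <= 1 ->
  {ae P, forall w : T,
     (limn_esup (fun n => (sin (vangle (rho_hat n w) (rho n)))%:E)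
       <= (zeta (varrho / sigma) c)%:E)%E}.
Proof.
move=> sigma0 nv nz ind c0 cp vr0 cr top z1.
have rho_pos : \forall n \near \oo, 0 < vnorm (rho n) by exact: cvgr_gt cr _ vr0.
have rho0 : \forall n \near \oo, rho n != 0.
  apply: filterS rho_pos => n; apply: contraTneq => ->.
  by rewrite /vnorm dotv0l sqrtr0 ltxx.
(* The hypothesis on [rho_hat] speaks of positive dimensions; [rho n != 0] excludes dimension 0. *)
have p0 : \forall n \near \oo, (0 < p n)%N.
  apply: filterS rho0 => n; apply: contraTltn; rewrite leqn0 => /eqP pn.
  by apply/negPn/eqP/matrixP => i; have := ltn_ord i; rewrite {2}pn.
pose m n := vnorm (rho n).
pose g n := Num.sqrt (m n ^+ 2 + sigma ^+ 2).
pose r n (j : 'I_(p n)) : R := ((m n)^-1 *: rho n) j 0.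
have r1 : \forall n \near \oo, \sum_j r n j ^+ 2 = 1.
  by apply: filterS rho0 => n rn; exact: sum_sqr_direction.
have b1 : \forall n \near \oo, (m n / g n) ^+ 2 + (sigma / g n) ^+ 2 = 1.
  by apply: filterS rho0 => n rn; exact: signal_weights.
have b1' : \forall n \near \oo, (m n / g n) ^+ 2 + \sum_j (sigma / g n * r n j) ^+ 2 = 1.
  near=> n; under eq_bigr do rewrite exprMn.
  rewrite -mulr_sumr (near r1 n)// mulr1; near: n; exact: b1.
(* Countably many slacks, so that one null set serves all of them. *)
pose e (k : nat) : R := k.+1%:R^-1.
have e0 k : 0 < e k by rewrite invr_gt0.
have ecvg : e @ \oo --> (0 : R) by exact: cvg_harmonic.
have [gap0 bound0] := angle_bound0_le_zeta sigma0 vr0 c0 z1.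
have E1 := ae_foralln (fun k => ae_sum_sqr_ge nv nz ind (e0 k) b1').
have E2 := ae_foralln (fun k => ae_noise_operator_le nv nz ind cp (e0 k)).
have E3 := ae_foralln (fun k => ae_cross_coord_le nv nz ind cp (e0 k) p0 r1 b1).
apply: filterS3 E1 E2 E3 => w E1 E2 E3.
apply/lee_addgt0Pr => eps eps0; apply: limn_esup_le_near; rewrite -EFinD.
have gapk : (fun k => gap sigma varrho c (e k)) @ \oo --> gap sigma varrho c 0.
  by apply: gap_cvg => //; exact: cvg_cst.
have boundk : (fun k => angle_bound sigma varrho c (e k)) @ \oo --> angle_bound sigma varrho c 0.
  by apply: angle_bound_cvg => //; [exact: lt0r_neq0|exact: cvg_cst|exact: cvg_cst].
(* The slack [e k] is fixed first, at the limiting parameters; only then does [n] grow. *)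
have hk : \forall k \near \oo, 0 < gap sigma varrho c (e k) /\
    angle_bound sigma varrho c (e k) < zeta (varrho / sigma) c + eps.
  near=> k; split; near: k; first exact: cvgr_gt gapk _ gap0.
  apply: cvgr_lt boundk _ _; lra.
have [k [gk bk]] := filter_ex hk.
have gapn : (fun n => gap sigma (m n) ((p n)%:R / n%:R) (e k)) @ \oo --> gap sigma varrho c (e k).
  by apply: gap_cvg => //; exact: cvg_cst.
have boundn : (fun n => angle_bound sigma (m n) ((p n)%:R / n%:R) (e k)) @ \oo -->
    angle_bound sigma varrho c (e k).
  by apply: angle_bound_cvg => //; [exact: lt0r_neq0|exact: cvg_cst].
near=> n; rewrite lee_fin.
apply: (@le_trans _ _ (angle_bound sigma (m n) ((p n)%:R / n%:R) (e k))); last first.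
  by apply: ltW; near: n; exact: cvgr_lt boundn _ bk.
have pn : (0 < p n)%N by near: n.
apply: (@sin_angle_le _ _ _ v z _ n w (rho n) sigma _ _ _ _ _ pn (top n w pn)) => //.
- by near: n; exact: nbhs_infty_gt.
- by near: n.
- exact: ltW.
- by near: n; exact: cvgr_gt gapn _ gk.
- by near: n; exact: E1.
- by near: n; exact: E2.
- by near: n; exact: E3.
Unshelve. all: by end_near. Qed.
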